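(* Let $\alpha\in\mathbb{N}$, $0<\sigma\le 1$ and $0<\rho\le 1$. Let $f$ be a $\log$-$\alpha$-analytic function on $\mathbb{D}$ satisfying $f(0)=\lambda_f(0)=1$, and put $F(z)=\log f(z)$. Suppose that $f$ is univalent in $\mathbb{D}_\rho$ and that $F(\mathbb{D}_\rho)\supset\mathbb{D}_\sigma$. Then the range $f(\mathbb{D}_\rho)$ contains the schlicht disk $\mathbb{D}(w_0,r_0)=\{w\in\mathbb{C}:|w-w_0|<r_0\}$, where $$w_0=\cosh\sigma,\qquad r_0=\sinh\sigma .$$ Moreover, if $\rho$ is the biggest univalent radius of $f$, then the radius $r_0=\sinh\sigma$ is sharp.
   Context: $\mathbb{N}=\{1,2,\ldots\}$, $\mathbb{D}$ is the open unit disk in $\mathbb{C}$ and $\mathbb{D}_r=\{z:|z|<r\}$. A continuous function $F:\Omega\to\mathbb{C}$ on a domain $\Omega\subseteq\mathbb{C}$ is polyanalytic of order $\alpha\in\mathbb{N}$ if $\partial^\alpha F/\partial\bar z^\alpha=0$ on $\Omega$; equivalently $F(z)=\sum_{k=0}^{\alpha-1}\bar z^kA_k(z)$ with each $A_k$ analytic. A function $f$ is $\log$-$\alpha$-analytic in a domain if $\log f$ is polyanalytic of order $\alpha$ there; $\log$ is the principal branch, with $\log 1=0$. For a $C^1$ function $f$, with $f_z=\frac12(f_x-if_y)$ and $f_{\bar z}=\frac12(f_x+if_y)$, set $\lambda_f(z)=\big||f_z(z)|-|f_{\bar z}(z)|\big|$. Univalent means injective. A schlicht disk in the range of $f$ is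 a disk which is the univalent (injective) image under $f$ of some region. The biggest univalent radius of $f$ is the largest $\rho$ such that $f$ is univalent in $\mathbb{D}_\rho$. ''Sharp'' means best possible: in the assertion it cannot in general be replaced by a larger number. *)

(* Defs.v *)
(* MathComp-Analysis. Complex numbers are R[i] for R : realType; the copy R[i]^o
   carries the topology of the modulus. The norm `|z| of z : R[i]^o is itself an
   element of R[i] (a nonnegative real), hence the %:C around real radii. *)
From HB Require Import structures.
From mathcomp Require Import all_boot all_order all_algebra.
From mathcomp Require Import complex.
From mathcomp Require Import all_classical all_reals all_analysis.
Import Order.TTheory GRing.Theory Num.Theory.
Import numFieldNormedType.Exports.

Set Implicit Arguments.
Unset Strict Implicit.
Unset Printing Implicit Defensive.

Local Open Scope classical_set_scope.
Local Open Scope complex_scope.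
Local Open Scope ring_scope.

Definition sinh {R : realType} (x : R) : R := (expR x - expR (- x)) / 2.
Definition cosh {R : realType} (x : R) : R := (expR x + expR (- x)) / 2.

Section Complex_analysis.
Variable R : realType.
Local Notation C := (R[i]^o).
Implicit Types (f F : C -> C) (z v w : C) (Omega : set C).

Definition disk w (r : R) : set C := ball w r%:C.

(* Principal argument, with values in ]-pi, pi] for w != 0. *)
Definition Arg w : R :=
  let t := acos (complex.Re w / complex.Re `|w|) in
  if 0 <= complex.Im w then t else - t.

(* Principal branch of the logarithm; the value at 0 is irrelevant. *)
Definition Log w : C := ln (complex.Re `|w|) +i* Arg w.

(* Derivative of f at z along v with respect to a REAL parameter. *)
Definition rderivable f v z : Prop :=
  derivable (fun t : R => complex.Re (f (z + t%:C * v)) : R^o) 0 1 /\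
  derivable (fun t : R => complex.Im (f (z + t%:C * v)) : R^o) 0 1.
Definition rderive f v z : C :=
  (fun t : R => complex.Re (f (z + t%:C * v)) : R^o)^`()%classic 0 +i*
  (fun t : R => complex.Im (f (z + t%:C * v)) : R^o)^`()%classic 0.

Definition dx f : C -> C := rderive f 1.
Definition dy f : C -> C := rderive f 'i%C.
Definition dz f : C -> C := fun z => (dx f z - 'i%C * dy f z) / 2%:R.
Definition dzbar f : C -> C := fun z => (dx f z + 'i%C * dy f z) / 2%:R.

Definition lambda f z : C := `| `|dz f z| - `|dzbar f z| |.

(* Meant for open Omega. *)
Definition C1_on Omega f : Prop :=
  [/\ {in Omega, continuous f},
      forall z, Omega z -> rderivable f 1 z /\ rderivable f 'i%C z,
      {in Omega, continuous (dx f)}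
    & {in Omega, continuous (dy f)}].

(* The iterated derivative is classical: each of F, dzbar F, ...,
   dzbar^(alpha - 1) F is C^1 on Omega. *)
Definition polyanalytic (alpha : nat) Omega F : Prop :=
  (forall k, (k < alpha)%N -> C1_on Omega (iter k dzbar F)) /\
  (forall z, Omega z -> iter alpha dzbar F z = 0).

Definition log_polyanalytic (alpha : nat) Omega f : Prop :=
  (forall z, Omega z -> f z <> 0) /\ polyanalytic alpha Omega (Log \o f).

Definition univalent_on Omega f : Prop := set_inj Omega f.

(* For f defined on the unit disk: only radii at most 1 make sense. *)
Definition biggest_univalent_radius f (rho : R) : Prop :=
  univalent_on (disk 0 rho) f /\
  forall rho' : R, 0 < rho' <= 1 -> univalent_on (disk 0 rho') f -> rho' <= rho.

Definition contains_schlicht_disk f Omega w0 (r : R) : Prop :=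
  exists U : set C,
    [/\ open U, connected U, U `<=` Omega, univalent_on U f
      & f @` U = disk w0 r].

Definition admissible (alpha : nat) (sigma rho : R) f : Prop :=
  [/\ log_polyanalytic alpha (disk 0 1) f,
      f 0 = 1,
      lambda f 0 = 1,
      univalent_on (disk 0 rho) f
    & disk 0 sigma `<=` (Log \o f) @` disk 0 rho].

(* For these parameters, the radius in the conclusion cannot be r, even if rho
   is the biggest univalent radius. *)
Definition radius_fails (alpha : nat) (sigma rho r : R) : Prop :=
  exists f, [/\ admissible alpha sigma rho f,
    biggest_univalent_radius f rho
  & ~ contains_schlicht_disk f (disk 0 rho) (cosh sigma)%:C r].

End Complex_analysis.

(* Main.v *)
Require Import Defs.
From mathcomp Require Import all_boot all_order all_algebra.
From mathcomp Require Import complex.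
From mathcomp Require Import all_classical all_reals all_analysis.
From mathcomp Require Import ring lra.
Import Order.TTheory GRing.Theory Num.Theory.
Import numFieldNormedType.Exports.

Set Implicit Arguments.
Unset Strict Implicit.
Unset Printing Implicit Defensive.

Local Open Scope classical_set_scope.
Local Open Scope complex_scope.
Local Open Scope ring_scope.

(** Put F = Log o f, so that f = exp o F on the unit disk.

    Containment.  The image of the disk of radius sigma under exp contains the
    disk centred at cosh sigma of radius sinh sigma: for w = exp (x + iy) with
    |y| < pi / 2, the inequality |w - cosh sigma| < sinh sigma reads
    cosh x < cos y cosh sigma, while cos y <= exp (- y^2 / 2) and the decrease
    of cosh t exp (- t^2 / 2) on t >= 0 give the reverse inequality as soon as
    x^2 + y^2 >= sigma^2 ([Log_disk_cosh]).  Hence every point of that disk W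
    is a value of f on the disk of radius rho, and the region sought is
    U = f^-1(W).  That U is connected is the delicate point, because f is
    only known to be continuous and injective: its Jacobian may vanish away
    from 0.  It follows from the continuity of the inverse of f on W, that
    is, from invariance of domain in the plane ([open_image]).

    Invariance of domain is proved with winding numbers reduced to the
    question whether a closed curve avoiding 0 has a continuous angle that
    takes the same value at both ends ([closed_angle]). The answer is
    unchanged along homotopies avoiding 0 ([closed_angle_homotopy]), it is no
    for a curve with g (t + pi) = - g t ([closed_angle_odd]), and it is yes
    for a constant curve. When f is continuous and injective on a disk |z| <=
    s, the curve f(z) - f(0) on its boundary is homotopic to an odd one
    through f (z / (1 + t)) - f (- t z / (1 + t)), which injectivity keeps
    away from 0; if f omitted a value q near f(0), then f(z) - q would be
    homotopic both to f(z) - f(0) and, shrinking the circle, to a constant.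

    Sharpness.  The point exp sigma = cosh sigma + sinh sigma lies in every
    larger disk with the same centre, so it suffices that F omits the value
    sigma on the disk of radius rho ([radius_fails_of_poly]).  When
    sigma = rho = 1, the map F(z) = z does it for every order.  For arbitrary
    sigma and rho take
      F (x + iy) = u(x) + K x y^2 + i v(y),
    a polynomial in z and its conjugate, hence polyanalytic of some order.  The
    odd polynomial v increases up to y = rho and decreases afterwards, so that
    rho is the biggest univalent radius, and it stays below 3/2 < pi, so that
    F is the principal logarithm of exp F.  The increasing polynomial u has
    u'(0) = 1 and u(rho) = sigma, so that sigma is the first real value that F
    misses.  A large K bends the image of the circle |z| = rho outwards, away
    from the disk of radius sigma which the image has to cover. *)

Local Notation Re := complex.Re.
Local Notation Im := complex.Im.

(** * Coordinates and topology of the complex plane *)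

Section Plane.
Variable R : realType.
Local Notation C := (R[i]^o).
Implicit Types (z w c : C) (r : R).

Lemma Re_add (z w : R[i]) : Re (z + w) = Re z + Re w.
Proof. by case: z; case: w. Qed.

Lemma Im_add (z w : R[i]) : Im (z + w) = Im z + Im w.
Proof. by case: z; case: w. Qed.

Lemma Re_opp (z : R[i]) : Re (- z) = - Re z.
Proof. by case: z. Qed.

Lemma Im_opp (z : R[i]) : Im (- z) = - Im z.
Proof. by case: z. Qed.

Lemma Re_mul (z w : R[i]) : Re (z * w) = Re z * Re w - Im z * Im w.
Proof. by case: z; case: w. Qed.

Lemma Im_mul (z w : R[i]) : Im (z * w) = Re z * Im w + Im z * Re w.
Proof. by case: z; case: w. Qed.

Definition ReImE := (Re_add, Im_add, Re_opp, Im_opp, Re_mul, Im_mul).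

Lemma complex_ext (z w : R[i]) : Re z = Re w -> Im z = Im w -> z = w.
Proof. by case: z => a b; case: w => c d /= -> ->. Qed.

Lemma normC_lt (z : R[i]) r : 0 < r ->
  (`|z| < r%:C) = (Re z ^+ 2 + Im z ^+ 2 < r ^+ 2).
Proof.
move=> r0; rewrite normc_def ltcR.
by rewrite -[X in _ < X](ger0_norm (ltW r0)) -sqrtr_sqr ltr_sqrt// exprn_gt0.
Qed.

Lemma normC_lt_Re z r : `|z| < r%:C -> 0 < r.
Proof. by move=> h; rewrite -ltcR; apply: le_lt_trans h; exact: normr_ge0. Qed.

Lemma diskE c r z : disk c r z <->
  0 < r /\ (Re z - Re c) ^+ 2 + (Im z - Im c) ^+ 2 < r ^+ 2.
Proof.
rewrite /disk -ball_normE /=; split=> [h|[r0 h]].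
  have r0 := normC_lt_Re h; split=> //; move: h.
  by rewrite normC_lt// !ReImE -[X in X + _ < _]sqrrN -[X in _ + X < _]sqrrN
    !opprB.
by rewrite normC_lt// !ReImE -[X in X + _ < _]sqrrN -[X in _ + X < _]sqrrN
  !opprB.
Qed.

Lemma ReIm0 (z : R[i]) : z != 0 -> 0 < Re z ^+ 2 + Im z ^+ 2.
Proof.
move=> z0; rewrite lt_neqAle addr_ge0 ?sqr_ge0// andbT eq_sym.
apply: contra z0; rewrite paddr_eq0 ?sqr_ge0// !sqrf_eq0 => /andP[/eqP a /eqP
  b].
by apply/eqP/complex_ext.
Qed.

Lemma cvg_ReIm T (F : set_system T) (FF : Filter F) (g : T -> C) z :
  Re (g t) @[t --> F] --> Re z -> Im (g t) @[t --> F] --> Im z -> g @ F --> z.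
Proof.
move=> hr hi; apply/cvgrPdist_lt => e e0.
have [e' -> {e0}e0] : exists2 e', e = e'%:C & 0 < e'.
  exists (Re e); first by rewrite RRe_real// gtr0_real.
  by move: e0; rewrite ltcE => /andP[].
have e2 : 0 < e' / 2 by rewrite divr_gt0.
move/cvgrPdist_lt : hr => /(_ _ e2) hr; move/cvgrPdist_lt : hi => /(_ _ e2) hi.
near=> t; rewrite normC_lt// !ReImE.
have h1 : `|Re z - Re (g t)| < e' / 2 by near: t.
have h2 : `|Im z - Im (g t)| < e' / 2 by near: t.
rewrite -(real_normK (num_real (Re z - _))) -(real_normK (num_real (Im z - _))).
have := normr_ge0 (Re z - Re (g t)); have := normr_ge0 (Im z - Im (g t)).
nra.
Unshelve. all: by end_near. Qed.

Lemma near_disk z r : 0 < r -> \forall w \near z, disk z r w.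
Proof. by move=> r0; apply: nbhsx_ballx; rewrite ltcR. Qed.

Lemma continuous_Re : continuous (@complex.Re R : C -> R).
Proof.
move=> z; apply/(@cvgrPdist_lt _ _ _ (nbhs (z : C))) => e e0.
apply: filterS (near_disk z e0) => w.
rewrite /disk -ball_normE /= => /(le_lt_trans (normc_ge_Re _)).
by rewrite ltcR !ReImE.
Qed.

Lemma continuous_Im : continuous (@complex.Im R : C -> R).
Proof.
move=> z; apply/(@cvgrPdist_lt _ _ _ (nbhs (z : C))) => e e0.
apply: filterS (near_disk z e0) => w.
move=> /diskE[_ h]; rewrite -ltr_sqr ?nnegrE ?(ltW e0)// real_normK ?num_real//.
by rewrite -sqrrN opprB; apply: le_lt_trans h; rewrite lerDr sqr_ge0.
Qed.

Lemma continuous_ReIm (T : topologicalType) (g : T -> C) x :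
  {for x, continuous (fun t => Re (g t))} ->
  {for x, continuous (fun t => Im (g t))} -> {for x, continuous g}.
Proof. by move=> hr hi; apply: cvg_ReIm. Qed.

Lemma for_continuous_Re (T : topologicalType) (g : T -> C) x :
  {for x, continuous g} -> {for x, continuous (fun t => Re (g t))}.
Proof. by move=> h; apply: (continuous_comp h); exact: continuous_Re. Qed.

Lemma for_continuous_Im (T : topologicalType) (g : T -> C) x :
  {for x, continuous g} -> {for x, continuous (fun t => Im (g t))}.
Proof. by move=> h; apply: (continuous_comp h); exact: continuous_Im. Qed.

Lemma open_disk c r : open (disk c r).
Proof.
have [r0|r0] := ltP 0 r; last first.
  rewrite (_ : disk c r = set0); first exact: open0.
  by apply/seteqP; split=> z // /diskE[]; rewrite ltNge r0.
by apply: ball_open; rewrite ltcR.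
Qed.

End Plane.

(** * Closed curves with a closed continuous angle *)

Section Winding.
Variable R : realType.
Local Notation C := (R[i]^o).

(** For a closed curve avoiding 0 this says that the winding number around 0
    vanishes; only the values between 0 and 2 pi
    matter. *)
Definition closed_angle (g : R -> C) : Prop :=
  exists b : R -> R, [/\ continuous b, b (pi *+ 2) = b 0 &
    forall t : R, 0 <= t <= pi *+ 2 -> exists2 m : R, 0 < m &
      g t = (m * cos (b t)) +i* (m * sin (b t))].

Definition clamp (x y t : R) := Num.max x (Num.min t y).

Lemma clamp_itv x y t : x <= y -> x <= clamp x y t <= y.
Proof. by move=> xy; rewrite le_max lexx ge_max xy ge_min lexx orbT. Qed.

Lemma clamp_id x y t : x <= t <= y -> clamp x y t = t.
Proof. by move=> /andP[h1 h2]; rewrite /clamp min_l// max_r. Qed.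

Lemma continuous_clamp x y : continuous (clamp x y).
Proof.
move=> t; apply: (@continuous_max _ _ (fun=> x) (fun t => Num.min t y)).
  exact: cvg_cst.
by apply: (@continuous_min _ _ id (fun=> y)); [exact: cvg_id|exact: cvg_cst].
Qed.

Lemma continuous_pair (T U V : topologicalType) (f : T -> U) (g : T -> V) x :
  {for x, continuous f} -> {for x, continuous g} ->
  {for x, continuous (fun t => (f t, g t))}.
Proof.
by move=> hf hg; exact: (@cvg_pair _ _ _ _ (nbhs (f x)) (nbhs (g x)) _ _ _ f g).
Qed.

Lemma pi2_ge0 : 0 <= pi *+ 2 :> R.
Proof. by rewrite mulrn_wge0// pi_ge0. Qed.

(** The positivity hypothesis keeps the quotient h / g in the right half-plane,
    where the arctangent of its slope is a continuous angle; this angle is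
    added to the one of g. *)
Lemma closed_angle_near (g h : R -> C) :
  continuous g -> continuous h -> g (pi *+ 2) = g 0 -> h (pi *+ 2) = h 0 ->
  (forall t : R, 0 <= t <= pi *+ 2 ->
    0 < Re (h t) * Re (g t) + Im (h t) * Im (g t)) ->
  closed_angle g -> closed_angle h.
Proof.
move=> gc hc g2 h2 pos [b [bc b2 bg]].
(* E and D are the coordinates of h times the conjugate of g; clamping keeps
   the quotient D / E continuous on the whole line. *)
pose E t := Re (h t) * Re (g t) + Im (h t) * Im (g t).
pose D t := Im (h t) * Re (g t) - Re (h t) * Im (g t).
pose cl := clamp 0 (pi *+ 2).
have clI t : 0 <= cl t <= pi *+ 2 by apply: clamp_itv; exact: pi2_ge0.
have [gR gI] : continuous (fun t => Re (g t)) /\ continuous (fun t => Im (g t)).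
  by split=> t; [apply: for_continuous_Re|apply: for_continuous_Im]; exact: gc.
have [hR hI] : continuous (fun t => Re (h t)) /\ continuous (fun t => Im (h t)).
  by split=> t; [apply: for_continuous_Re|apply: for_continuous_Im]; exact: hc.
have Ec : continuous E.
  by move=> t; apply: cvgD; apply: cvgM;
    [exact: hR|exact: gR|exact: hI|exact: gI].
have Dc : continuous D.
  by move=> t; apply: cvgB; apply: cvgM;
    [exact: hI|exact: gR|exact: hR|exact: gI].
exists (fun t => b t + atan (D (cl t) / E (cl t))); split.
- move=> t; apply: cvgD; first exact: bc.
  apply: (continuous_comp (f := fun t => D (cl t) / E (cl t)));
    last exact: continuous_atan.
  apply: (continuous_comp (f := cl) (g := fun t => D t / E t)).
    exact: continuous_clamp.
  apply: cvgM; first exact: Dc.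
  by apply: cvgV; [rewrite gt_eqF//; exact: pos|exact: Ec].
- rewrite b2 /cl !clamp_id ?lexx ?pi2_ge0//.
  by rewrite /D /E g2 h2.
move=> t tI; have [m m0 gt] := bg t tI.
rewrite /cl clamp_id//; have Et : 0 < E t by exact: pos.
set a := atan _.
have ca : 0 < cos a by apply: cos_gt0_pihalf; rewrite atan_gtNpi2 atan_ltpi2.
have Dt : D t = E t * (sin a / cos a).
  by rewrite -/(tan a) /a atanK mulrC divfK// gt_eqF.
exists (E t / (cos a * m)); first by rewrite divr_gt0// mulr_gt0.
have hg : h t * (Re (g t) ^+ 2 + Im (g t) ^+ 2)%:C = (E t +i* D t) * g t.
  by apply: complex_ext; rewrite !ReImE /= /E /D; ring.
have gm : Re (g t) ^+ 2 + Im (g t) ^+ 2 = m ^+ 2.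
  by rewrite gt /= !exprMn -mulrDr cos2Dsin2 mulr1.
move: hg; rewrite gm gt => hg.
have m2 : m ^+ 2 != 0 by rewrite expf_eq0 gt_eqF.
have ca0 : cos a != 0 by rewrite gt_eqF.
have hE : h t * (m ^+ 2)%:C = (E t / (cos a * m) * cos (b t + a) * m ^+ 2) +i*
  (E t / (cos a * m) * sin (b t + a) * m ^+ 2).
  rewrite hg Dt; apply: complex_ext; rewrite !ReImE /= ?cosD ?sinD.
    by field; rewrite ca0 gt_eqF.
  by field; rewrite ca0 gt_eqF.
have m2C : (m ^+ 2)%:C != 0 :> R[i] by rewrite eq_complex /= negb_and m2.
apply: (@mulIf R[i] _ m2C (h t) (_ +i* _)).
by rewrite hE; apply: complex_ext; rewrite !ReImE /=; ring.
Qed.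

(** The set of parameters with a closed angle is open and so is its complement:
    by compactness of the segment from 0 to 2 pi, neighbouring curves of the
      homotopy satisfy
    the hypothesis of [closed_angle_near] in both directions. *)
Lemma closed_angle_homotopy (H : R -> R -> C) :
  continuous (fun z : R * R => H z.1 z.2) ->
  (forall s t, 0 <= t <= pi *+ 2 -> H s t != 0) ->
  (forall s, H s (pi *+ 2) = H s 0) ->
  forall s s', closed_angle (H s) -> closed_angle (H s').
Proof.
move=> Hc H0 H2.
have Hs s : continuous (H s).
  move=> t; apply: (continuous_comp (f := fun t => (s, t)) (g :=
    fun z : R * R => H z.1 z.2)).
    by apply: continuous_pair; [exact: cvg_cst|exact: cvg_id].
  exact: Hc.
pose P s s' := forall t : R, 0 <= t <= pi *+ 2 ->
  0 < Re (H s t) * Re (H s' t) + Im (H s t) * Im (H s' t).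
have near s : \forall s' \near s, P s' s.
  have /compact_near_coveringP : compact `[0, pi *+ 2 :
    R]%classic by exact: segment_compact.
  move=> /(_ _ (nbhs s) (fun s' t => 0 < Re (H s' t) * Re (H s t) + Im (H s'
    t) * Im (H s t))).
  move=> /(_ _) h; have : \forall s' \near s, `[0, pi *+ 2 : R]%classic `<=`
    (fun t => 0 < Re (H s' t) * Re (H s t) + Im (H s' t) * Im (H s t)).
    apply: h => t; rewrite /= in_itv /= => tI.
    pose G (z : R * R) := Re (H z.2 z.1) * Re (H s z.1) + Im (H z.2 z.1) * Im
      (H s z.1).
    have H1 (z : R * R) : {for z, continuous (fun z : R * R => H z.2 z.1)}.
      apply: (continuous_comp (f := fun z : R * R => (z.2, z.1)) (g :=
        fun z : R * R => H z.1 z.2)).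
        by apply: continuous_pair; [exact: cvg_snd|exact: cvg_fst].
      exact: Hc.
    have H3 (z : R * R) : {for z, continuous (fun z : R * R => H s z.1)}.
      apply: (continuous_comp (f := fun z : R * R => z.1) (g := H s));
        first exact: cvg_fst.
      exact: Hs.
    have Gc : {for (t, s), continuous G}.
      have c1 := for_continuous_Re (H1 (t, s));
        have c2 := for_continuous_Re (H3 (t, s)).
      have c3 := for_continuous_Im (H1 (t, s));
        have c4 := for_continuous_Im (H3 (t, s)).
      exact: (cvgD (cvgM c1 c2) (cvgM c3 c4)).
    have G0 : 0 < G (t, s) by rewrite /G /= -!expr2; apply: ReIm0; exact: H0.
    exact: (cvgr_gt (G (t, s)) Gc _ G0).
  by apply: filterS => s' h' t tI; apply: h'; rewrite /= in_itv.
have step s s' : P s s' -> closed_angle (H s) <-> closed_angle (H s').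
  move=> h; split=> ch.
    apply: (closed_angle_near (Hs s) (Hs s') (H2 s) (H2 s') _ ch) => t tI.
    by have := h t tI; rewrite (mulrC (Re (H s t))) (mulrC (Im (H s t))).
  exact: (closed_angle_near (Hs s') (Hs s) (H2 s') (H2 s) h ch).
have op (b : Prop) : open [set s | closed_angle (H s) <-> b].
  rewrite openE => s /= hs; apply: filterS (near s) => s' /step hs' /=.
  by split=> [/hs'/hs//|/hs/hs'].
move=> s s' cs.
suff : [set s | closed_angle (H s)] = setT by move/seteqP => [_ /(_ s' I)].
have /(_ [set s | closed_angle (H s)]) :
  connected ([set: R]) by apply/connected_intervalP.
apply.
- by exists s.
- exists [set s | closed_angle (H s) <-> True]; first exact: op.
  by rewrite setTI; apply/seteqP; split=> x /=; tauto.
- exists (~` [set s | closed_angle (H s) <-> False]);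
    first by apply: open_closedC; exact: op.
  rewrite setTI; apply/seteqP; split=> x /=; first by tauto.
  by move=> h; apply: contrapT => h'; apply: h; split.
Qed.

(** The increment c(t) = b(t + pi) - b(t) of a closed angle b satisfies
    c(pi) = - c(0), hence vanishes somewhere; there g (t + pi) would be a
    positive multiple of g t. *)
Lemma closed_angle_odd (g : R -> C) :
  (forall t, g (t + pi) = - g t) -> ~ closed_angle g.
Proof.
move=> godd [b [bc b2 bg]].
pose c t := b (t + pi) - b t.
have pi0 := pi_ge0 R.
have ccos t : 0 <= t <= pi -> cos (c t) < 0.
  move=> /andP[t0 tp].
  have [|m m0 gm] := bg t; first by rewrite t0 mulr2n (le_trans tp)// lerDl.
  have [|n n0 gn] := bg (t + pi); first by rewrite addr_ge0// mulr2n lerD2r.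
  move: gn; rewrite godd gm => -[e1 e2].
  rewrite /c cosB.
  have : n * m * (cos (b (t + pi)) * cos (b t) + sin (b (t + pi)) * sin (b t))
    = - m ^+ 2.
    rewrite (_ : _ * _ = (n * cos (b (t + pi))) * (m * cos (b t)) + (n * sin
      (b (t + pi))) * (m * sin (b t))); last by ring.
    rewrite -e1 -e2 -[RHS]mulr1 -(cos2Dsin2 (b t)); ring.
  move=> h; rewrite -(pmulr_rlt0 _ (mulr_gt0 n0 m0)) h oppr_lt0 exprn_gt0//.
have cc : continuous c.
  move=> t; apply: cvgB; last exact: bc.
  apply: (continuous_comp (f := fun t => t + pi)); last exact: bc.
  by apply: cvgD; [exact: cvg_id|exact: cvg_cst].
have cpi : c pi = - c 0 by rewrite /c add0r opprB -mulr2n b2.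
have [] := @IVT R c 0 pi 0 pi0.
- exact: continuous_subspaceT.
- rewrite cpi ge_min le_max oppr_ge0 oppr_le0.
  by have [h|/ltW h] := leP (c 0) 0; rewrite ?h ?orbT.
move=> t; rewrite in_itv /= => tI ct; have := ccos t tI.
by rewrite ct cos0 ltr10.
Qed.

End Winding.

(** * The exponential and the principal logarithm *)

Section ExpLog.
Variable R : realType.
Local Notation C := (R[i]^o).
Implicit Types w z : C.

Lemma Re_norm (w : R[i]) : Re `|w| = Num.sqrt (Re w ^+ 2 + Im w ^+ 2).
Proof. by rewrite normc_def. Qed.

Lemma Re_norm_gt0 (w : R[i]) : w != 0 -> 0 < Re `|w|.
Proof. by move=> w0; rewrite Re_norm sqrtr_gt0 ReIm0. Qed.

Lemma sqr_Re_norm (w : R[i]) : Re `|w| ^+ 2 = Re w ^+ 2 + Im w ^+ 2.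
Proof. by rewrite Re_norm sqr_sqrtr// addr_ge0// sqr_ge0. Qed.

Lemma Arg_polar w : w != 0 ->
  w = (Re `|w| * cos (Arg w)) +i* (Re `|w| * sin (Arg w)).
Proof.
move=> w0; have m0 := Re_norm_gt0 w0; have mE := sqr_Re_norm w.
set m := Re `|w| in m0 mE *; set x := Re w / m.
have m0' : m != 0 by rewrite gt_eqF.
have xE : 1 - x ^+ 2 = (Im w / m) ^+ 2.
  rewrite /x !expr_div_n mE -[X in X - _](@divff _ (m ^+ 2)) ?expf_eq0// mE.
  by rewrite -mulrBl addrC addKr.
have xI : -1 <= x <= 1.
  by rewrite -ler_norml -sqrtr_sqr -sqrtr1 ler_sqrt// -subr_ge0 xE sqr_ge0.
have sx : sin (acos x) = `|Im w| / m.
  by rewrite sin_acos// xE sqrtr_sqr normrM normfV (gtr0_norm m0).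
apply: complex_ext => /=; rewrite /Arg -/m -/x.
  by case: ifP; rewrite ?cosN acosK ?in_itv//= /x mulrC divfK.
case: leP => h; rewrite ?sinN sx ?(ger0_norm h) ?(ltr0_norm h) ?mulNr ?opprK.
  by rewrite mulrC divfK.
by rewrite mulrC divfK.
Qed.

Lemma Arg_lt_pihalf w : 0 < Re w -> - (pi / 2) < Arg w < pi / 2.
Proof.
move=> w0; have wn0 : w != 0 by apply: contraTneq w0 => ->; rewrite ltxx.
have m0 := Re_norm_gt0 wn0; have mE := sqr_Re_norm w.
have xI : 0 < Re w / Re `|w| <= 1.
  rewrite divr_gt0//= ler_pdivrMr// mul1r -ler_sqr ?nnegrE ?(ltW m0) ?(ltW
    w0)// mE.
  by rewrite lerDl sqr_ge0.
have xI' : -1 <= Re w / Re `|w| <= 1.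
  by case/andP: xI => h ->; rewrite (le_trans _ (ltW h))// lerN10.
have a2 : acos (Re w / Re `|w|) < pi / 2.
  have /andP[x0 x1] := xI; rewrite -ltr_cos ?in_itv /=.
  - by rewrite cos_pihalf acosK// in_itv.
  - by rewrite acos_ge0// acos_lepi.
  - by rewrite divr_ge0 ?pi_ge0//= ler_pdivrMr// ler_peMr ?pi_ge0// ler1n.
have a0 := acos_ge0 xI'; have p2 : 0 < pi / 2 :> R by rewrite divr_gt0// pi_gt0.
by rewrite /Arg; case: ifP => _; [rewrite a2 andbT|rewrite ltrN2 a2/=]; lra.
Qed.

Definition cexp w : C := (expR (Re w) * cos (Im w)) +i* (expR (Re w) * sin (Im
  w)).

Lemma cexp_neq0 w : cexp w != 0.
Proof.
apply/eqP => -[/eqP h1 /eqP h2]; have := cos2Dsin2 (Im w); move: h1 h2.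
rewrite !mulf_eq0 (gt_eqF (expR_gt0 _)) /= => /eqP -> /eqP ->.
by rewrite expr0n addr0 => /esym/eqP; rewrite oner_eq0.
Qed.

Lemma norm_cexp w : Re `|cexp w| = expR (Re w).
Proof.
by rewrite Re_norm /= !exprMn -mulrDr cos2Dsin2 mulr1 sqrtr_sqr ger0_norm
  ?expR_ge0//.
Qed.

Lemma LogK w : w != 0 -> cexp (Log w) = w.
Proof.
move=> w0; rewrite [RHS]Arg_polar// /cexp /Log /= lnK//.
by rewrite posrE Re_norm_gt0.
Qed.

Lemma cexpK w : - pi < Im w <= pi -> Log (cexp w) = w.
Proof.
move=> /andP[h1 h2]; rewrite /Log norm_cexp expRK; apply: complex_ext => //=.
rewrite /Arg norm_cexp /= [expR _ * cos _]mulrC mulfK ?gt_eqF ?expR_gt0//.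
rewrite pmulr_rge0 ?expR_gt0//; have [i0|i0] := leP 0 (Im w).
  by rewrite sin_ge0_pi ?i0// cosK// in_itv /= i0.
have s0 : sin (Im w) < 0.
  by rewrite -oppr_gt0 -sinN; apply: sin_gt0_pi; rewrite oppr_gt0 i0 ltrNl.
rewrite leNgt s0 /=.
by rewrite cosKN ?opprK// !ltW.
Qed.

Lemma Log_inj w z : w != 0 -> z != 0 -> Log w = Log z -> w = z.
Proof. by move=> w0 z0 h; rewrite -[LHS](LogK w0) -[RHS](LogK z0) h. Qed.

Lemma for_continuous_cexp (T : topologicalType) (F : T -> C) x :
  {for x, continuous F} -> {for x, continuous (fun t => cexp (F t))}.
Proof.
move=> Fc; have FR := for_continuous_Re Fc; have FI := for_continuous_Im Fc.
have eR : {for x, continuous (fun t => expR (Re (F t)))}.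
  by apply: (continuous_comp FR); exact: continuous_expR.
apply: continuous_ReIm => /=; apply: (cvgM eR); apply: (continuous_comp FI).
  exact: continuous_cos.
exact: continuous_sin.
Qed.

End ExpLog.

(** * Invariance of domain in the plane *)

Section InvarianceOfDomain.
Variable R : realType.
Local Notation C := (R[i]^o).
Implicit Types (c q : C) (r t u : R).

Definition polar c (u t : R) : C :=
  (Re c + u * cos t) +i* (Im c + u * sin t).

Lemma polarDpi c u t : polar c u (t + pi) = polar c (- u) t.
Proof. by rewrite /polar cosDpi sinDpi !mulrN !mulNr. Qed.

Lemma polar0 c t : polar c 0 t = c.
Proof. by apply: complex_ext; rewrite /= mul0r addr0. Qed.

Lemma polar_in_disk c r u t : `|u| < r -> disk c r (polar c u t).
Proof.
move=> ur; apply/diskE; split; first exact: le_lt_trans ur.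
rewrite /= ![_ + _ * _ - _]addrAC !subrr !add0r !exprMn -mulrDr cos2Dsin2 mulr1.
have r0 : 0 < r by exact: le_lt_trans ur.
by rewrite -(real_normK (num_real u)) ltr_sqr ?nnegrE ?(ltW r0).
Qed.

Lemma polar_inj c u u' t : polar c u t = polar c u' t -> u = u'.
Proof.
move=> [/addrI h1 /addrI h2].
by rewrite -[u]mulr1 -[u']mulr1 -(cos2Dsin2 t) !mulrDr !expr2 !mulrA h1 h2.
Qed.

Lemma continuous_polar c (T : topologicalType) (u v : T -> R) x :
  {for x, continuous u} -> {for x, continuous v} ->
  {for x, continuous (fun z => polar c (u z) (v z))}.
Proof.
move=> uc vc.
have cc : {for x, continuous (fun z => cos (v z))}.
  by apply: (continuous_comp vc); exact: continuous_cos.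
have sc : {for x, continuous (fun z => sin (v z))}.
  by apply: (continuous_comp vc); exact: continuous_sin.
apply: continuous_ReIm => /=.
  exact: (cvgD (cvg_cst _) (cvgM uc cc)).
exact: (cvgD (cvg_cst _) (cvgM uc sc)).
Qed.

Lemma closed_angle_cst q : q != 0 -> closed_angle (fun=> q).
Proof.
move=> q0; exists (fun=> Arg q); split=> // [|t _]; first exact: cst_continuous.
by exists (Re `|q|); [exact: Re_norm_gt0|exact: Arg_polar].
Qed.

(** The radius d is the distance from f(c) to the image of a circle around c;
    a value q omitted within that distance contradicts [closed_angle_odd]
    through the homotopies H1, H2 and H3 of the proof. *)
Lemma open_image (f : C -> C) c r : 0 < r ->
  (forall z, disk c r z -> {for z, continuous f}) -> set_inj (disk c r) f ->
  exists2 d, 0 < d & disk (f c) d `<=` f @` disk c r.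
Proof.
move=> r0 fc fi.
pose s := r / 2; have s0 : 0 < s by rewrite divr_gt0.
have sr : s < r by rewrite /s; lra.
have fi' z w : disk c r z -> disk c r w -> f z = f w -> z = w.
  by move=> zD wD; apply: fi; rewrite inE.
have cc : disk c r c by rewrite -[X in disk _ _ X](polar0 c 0);
  apply: polar_in_disk; rewrite normr0.
pose k u := clamp 0 1 u : R.
have kI u : 0 <= k u <= 1 by apply: clamp_itv.
have kc : continuous k by exact: continuous_clamp.
have pD u t : `|u| <= s -> disk c r (polar c u t).
  by move=> us; apply: polar_in_disk; exact: le_lt_trans sr.
have kfst (z : R * R) : {for z, continuous (fun z : R * R => k z.1)}.
  by apply: (continuous_comp (f := fst)); [exact: cvg_fst|exact: kc].
have fpol (u : R * R -> R) (z : R * R) : (forall z, `|u z| <= s) ->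
    {for z, continuous u} -> {for z, continuous (fun z => f (polar c (u z)
      z.2))}.
  move=> us uc; apply: (continuous_comp (f := fun z => polar c (u z) z.2)).
    have sc : {for z, continuous (fun z : R * R => z.2)} by exact: cvg_snd.
    exact: (continuous_polar (c := c) uc sc).
  by apply: fc; exact: pD.
have per u : polar c u (pi *+ 2) = polar c u 0.
  by rewrite /polar cos2pi sin2pi cos0 sin0.
(* H1 joins f(z) - f(c), with z on the circle of radius s, to an odd curve. *)
pose H1 u t := f (polar c (s / (1 + k u)) t) - f (polar c (- (k u * s / (1 + k
  u))) t).
have k1 u : 0 < 1 + k u by have /andP[] := kI u; lra.
have ub u : `|s / (1 + k u)| <= s.
  have k1u := k1 u; rewrite ger0_norm; last by apply: divr_ge0; exact: ltW.
  rewrite ler_pdivrMr// ler_peMr ?(ltW s0)//.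
  by have /andP[] := kI u; lra.
have vb u : `|- (k u * s / (1 + k u))| <= s.
  have /andP[k0 k1'] := kI u.
  have k1u := k1 u; rewrite normrN ger0_norm; last first.
    by apply: divr_ge0; [apply: mulr_ge0; [|exact: ltW]|exact: ltW].
  by rewrite ler_pdivrMr// mulrC ler_wpM2l ?(ltW s0)// lerDr.
have kV (z : R * R) : {for z, continuous (fun z : R * R => (1 + k z.1)^-1)}.
  apply: cvgV; first by rewrite gt_eqF.
  exact: (cvgD (cvg_cst _) (kfst z)).
have H1c : continuous (fun z : R * R => H1 z.1 z.2).
  move=> z; apply: cvgB; apply: fpol => //.
    exact: (cvgM (cvg_cst _) (kV z)).
  exact: (cvgN (cvgM (cvgM (kfst z) (cvg_cst _)) (kV z))).
have H1n u t : H1 u t != 0.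
  rewrite subr_eq0; apply/eqP => /(fi' _ _ (pD _ _ (ub u)) (pD _ _ (vb u))).
  move=> /polar_inj h; have : 0 < s / (1 + k u) by rewrite divr_gt0.
  have /andP[k0 _] := kI u; rewrite h oppr_gt0 ltNge divr_ge0 ?(ltW (k1 u))//.
  by rewrite mulr_ge0// ltW.
have H1p u : H1 u (pi *+ 2) = H1 u 0 by rewrite /H1 !per.
have k0E : k 0 = 0 by rewrite /k clamp_id// lexx ler01.
have k1E : k 1 = 1 by rewrite /k clamp_id// lexx ler01.
have odd1 : ~ closed_angle (H1 1).
  apply: closed_angle_odd => t.
  by rewrite /H1 !polarDpi k1E mul1r opprK opprB.
have ncirc : ~ closed_angle (fun t => f (polar c s t) - f c).
  move=> h; apply: odd1.
  apply: (closed_angle_homotopy H1c (fun u t _ => H1n u t) H1p (s := 0)).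
  rewrite (_ : H1 0 = (fun t => f (polar c s t) - f c))//.
  by apply/funext => t; rewrite /H1 k0E !mul0r oppr0 addr0 divr1 polar0.
pose N t := Re (f (polar c s t) - f c) ^+ 2 + Im (f (polar c s t) - f c) ^+ 2.
have ss : `|s| <= s by rewrite ger0_norm// ltW.
have fsc (t : R) : {for t, continuous (fun t => f (polar c s t) - f c)}.
  apply: cvgB; last exact: cvg_cst.
  apply: (continuous_comp (f := fun t => polar c s t)).
    by apply: continuous_polar; [exact: cvg_cst|exact: cvg_id].
  by apply: fc; exact: pD.
have Nc : continuous N.
  move=> t; have c1 := for_continuous_Re (fsc t);
    have c2 := for_continuous_Im (fsc t).
  exact: (cvgD (cvgM c1 c1) (cvgM c2 c2)).
have N0 t : 0 < N t.
  apply: ReIm0; rewrite subr_eq0; apply/eqP => /(fi' _ _ (pD _ _ ss) cc).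
  rewrite -[RHS](polar0 c t) => /polar_inj => h.
  by move: s0; rewrite h ltxx.
have [t0 _ t0min] := @EVT_min R N 0 (pi *+ 2) (pi2_ge0 R)
  (continuous_subspaceT Nc).
exists (Num.sqrt (N t0)); first by rewrite sqrtr_gt0.
move=> q /diskE[_]; rewrite sqr_sqrtr ?(ltW (N0 _))// => qd.
apply: contrapT => qn; apply: ncirc.
have qf z : disk c r z -> f z != q.
  by move=> zD; apply/eqP => zq; apply: qn; exists z.
(* H2 moves the base point from f(c) to q, and H3 shrinks the circle to c. *)
pose H2 u t := f (polar c s t) - (f c + (k u)%:C * (q - f c)).
pose H3 u t := f (polar c (k u * s) t) - q.
have kb u : `|k u * s| <= s.
  have /andP[k0 k1'] := kI u.
  rewrite ger0_norm; last by apply: mulr_ge0; [|exact: ltW].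
  by rewrite ler_piMl ?(ltW s0).
have kCc (z : R * R) : {for z, continuous (fun z : R * R => (k z.1)%:C : C)}.
  by apply: continuous_ReIm => /=; [exact: kfst|exact: cvg_cst].
have a3 : closed_angle (H3 1).
  apply: (@closed_angle_homotopy R H3 _ _ _ 0).
  - move=> z; apply: cvgB; last exact: cvg_cst.
    apply: fpol => //; exact: (cvgM (kfst z) (cvg_cst _)).
  - by move=> u t _; rewrite subr_eq0; apply: qf; exact: pD.
  - by move=> u; rewrite /H3 per.
  - rewrite (_ : H3 0 = (fun=> f c - q)).
      by apply: closed_angle_cst; rewrite subr_eq0 qf.
    by apply/funext => t; rewrite /H3 k0E mul0r polar0.
have a2 : closed_angle (H2 1).
  rewrite (_ : H2 1 = H3 1)//; apply/funext => t.
  by rewrite /H2 /H3 k1E !mul1r addrCA subrr addr0.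
have : closed_angle (H2 0).
  apply: (@closed_angle_homotopy R H2 _ _ _ 1) a2.
  - move=> z; apply: cvgB; first by apply: fpol => //; exact: cvg_cst.
    exact: (cvgD (cvg_cst _) (cvgM (kCc z) (cvg_cst _))).
  - move=> u t tI; rewrite subr_eq0; apply/eqP => fE.
    have /andP[k0 k1'] := kI u.
    have NE : N t = k u ^+ 2 * ((Re q - Re (f c)) ^+ 2 + (Im q - Im (f c)) ^+
      2).
      by rewrite /N fE !ReImE /=; ring.
    have tmin : N t0 <= N t by apply: t0min; rewrite in_itv.
    suff : N t < N t0 by rewrite ltNge tmin.
    rewrite NE; apply: le_lt_trans qd.
    by rewrite ler_piMl ?addr_ge0 ?sqr_ge0// expr_le1.
  - by move=> u; rewrite /H2 per.
rewrite (_ : H2 0 = (fun t => f (polar c s t) - f c))//.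
by apply/funext => t; rewrite /H2 k0E mul0r addr0.
Qed.

End InvarianceOfDomain.

(** * The image of a disk under the exponential *)

Section Hyperbolic.
Variable R : realType.
Local Notation C := (R[i]^o).
Implicit Types (x y t s : R) (w : C).

Lemma derive_ge0_le (f f' : R -> R) (a b : R) :
  (forall t, is_derive t (1 : R) f (f' t)) -> a <= b ->
  (forall t, a < t < b -> 0 <= f' t) -> f a <= f b.
Proof.
move=> fd b0 f'0; have fd1 t : derivable f t 1 by have [] := fd t.
apply: (@ger0_derive1_ndecr R f a b) => //.
- move=> t; rewrite in_itv /= => /f'0.
  by rewrite derive1E; have [_ ->] := fd t.
- apply: continuous_subspaceT => t; apply: differentiable_continuous.
  exact/derivable1_diffP.
Qed.

Lemma is_derive_cosh t : is_derive t (1 : R) (@cosh R) (sinh t).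
Proof.
rewrite /cosh; apply: is_derive_eq.
rewrite /sinh /GRing.scale /=; ring.
Qed.

Lemma is_derive_sinh t : is_derive t (1 : R) (@sinh R) (cosh t).
Proof.
rewrite /sinh; apply: is_derive_eq.
rewrite /cosh /GRing.scale /=; ring.
Qed.

Lemma cosh_ge1 t : 1 <= cosh t.
Proof.
rewrite /cosh expRN; have e0 := expR_gt0 t.
have : 0 <= (expR t - 1) ^+ 2 / expR t by rewrite divr_ge0 ?sqr_ge0// ltW.
rewrite (_ : _ / _ = expR t + (expR t)^-1 - 2); first by lra.
by field; rewrite gt_eqF.
Qed.

Lemma sinh_ge0 t : 0 <= t -> 0 <= sinh t.
Proof.
move=> t0; rewrite divr_ge0// subr_ge0 ler_expR; lra.
Qed.

Lemma sinh0 : sinh 0 = 0 :> R.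
Proof. by rewrite /sinh oppr0 subrr mul0r. Qed.

Lemma cosh2Bsinh2 t : cosh t ^+ 2 - sinh t ^+ 2 = 1.
Proof.
rewrite /cosh /sinh expRN; have := expR_gt0 t => e0; field; exact: lt0r_neq0.
Qed.

Lemma coshN t : cosh (- t) = cosh t.
Proof. by rewrite /cosh opprK addrC. Qed.

Lemma ler_cosh s t : 0 <= s -> s <= t -> cosh s <= cosh t.
Proof.
move=> s0 st; apply: (derive_ge0_le is_derive_cosh st) => u /andP[su _].
by apply: sinh_ge0; apply: le_trans (ltW su).
Qed.

(** The derivative of u cosh u - sinh u is u sinh u. *)
Lemma sinh_le_tcosh t : 0 <= t -> sinh t <= t * cosh t.
Proof.
move=> t0; rewrite -subr_ge0.
have := @derive_ge0_le (fun u => u * cosh u - sinh u) (fun u => u * sinh u) 0 t.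
rewrite mul0r sinh0 subr0; apply => //.
  move=> u; have d1 := is_derive_cosh u; have d2 := is_derive_sinh u.
  by apply: is_derive_eq; rewrite /GRing.scale /=; ring.
by move=> u /andP[u0 _]; rewrite mulr_ge0 ?(ltW u0)// sinh_ge0// ltW.
Qed.

(** The derivative of sin u - u cos u is u sin u. *)
Lemma tcos_le_sin t : 0 <= t <= pi / 2 -> t * cos t <= sin t.
Proof.
move=> /andP[t0 tp]; rewrite -subr_ge0.
have := @derive_ge0_le (fun u => sin u - u * cos u) (fun u => u * sin u) 0 t.
rewrite mul0r sin0 subr0; apply => //.
  by move=> u; apply: is_derive_eq; rewrite /GRing.scale /=; ring.
move=> u /andP[u0 ut]; rewrite mulr_ge0 ?(ltW u0)// sin_ge0_pi// ltW//=.
by have := pi_gt0 R; lra.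
Qed.

Lemma cos_le_gauss y : - (pi / 2) < y < pi / 2 ->
  cos y <= expR (- (y ^+ 2 / 2)).
Proof.
wlog y0 : y / 0 <= y.
  move=> h; have [/h//|y0 /andP[y1 y2]] := leP 0 y.
  by rewrite -cosN -sqrrN; apply: h; lra.
move=> /andP[_ y1].
have := @derive_ge0_le (fun u => - (cos u * expR (u ^+ 2 / 2)))
  (fun u => (sin u - u * cos u) * expR (u ^+ 2 / 2)) 0 y.
rewrite cos0 mul1r expr0n mul0r expR0 => h.
have {}h : - 1 <= - (cos y * expR (y ^+ 2 / 2)).
  apply: h => //.
    by move=> u; apply: is_derive_eq; rewrite /GRing.scale /=; field.
  move=> u /andP[u0 uy]; rewrite mulr_ge0 ?expR_ge0// subr_ge0 tcos_le_sin//.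
  by rewrite ltW//=; lra.
by rewrite expRN -[leRHS]mul1r ler_pdivlMr ?expR_gt0// -lerN2.
Qed.

Lemma cosh_gauss_decr s t : 0 <= s -> s <= t ->
  cosh t * expR (- (t ^+ 2 / 2)) <= cosh s * expR (- (s ^+ 2 / 2)).
Proof.
move=> s0 st; rewrite -lerN2.
apply: (@derive_ge0_le (fun u => - (cosh u * expR (- (u ^+ 2 / 2))))
  (fun u => (u * cosh u - sinh u) * expR (- (u ^+ 2 / 2))) s t) => //.
  move=> u; have d1 := is_derive_cosh u.
  by apply: is_derive_eq; rewrite /GRing.scale /=; field.
move=> u /andP[u0 uy]; rewrite mulr_ge0 ?expR_ge0// subr_ge0 sinh_le_tcosh//.
by apply: le_trans (ltW u0).
Qed.

(** If x^2 + y^2 >= s^2 and |x| < s, then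
    cos y cosh s <= exp (- y^2 / 2) cosh x exp ((s^2 - x^2) / 2) <= cosh x;
    if |x| >= s, then cosh x >= cosh s already. *)
Lemma coshcos_lt s x y : 0 < s -> - (pi / 2) < y < pi / 2 ->
  cosh x < cos y * cosh s -> x ^+ 2 + y ^+ 2 < s ^+ 2.
Proof.
move=> s0 yI; wlog x0 : x / 0 <= x.
  move=> h; have [/h//|x0] := leP 0 x.
  by rewrite -coshN -sqrrN; apply: h; lra.
move=> hlt; rewrite ltNge; apply/negP => hge; move: hlt; apply/negP;
  rewrite -leNgt.
have cy : 0 < cos y by exact: cos_gt0_pihalf.
have [sx|xs] := leP s x.
  apply: le_trans (ler_cosh (ltW s0) sx).
  by rewrite ler_piMl ?cos_le1// (le_trans _ (cosh_ge1 s)).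
have h1 := cosh_gauss_decr x0 (ltW xs).
have h2 := cos_le_gauss yI.
have cs : 0 <= cosh s by rewrite (le_trans _ (cosh_ge1 s)).
have cx : 0 <= cosh x by rewrite (le_trans _ (cosh_ge1 x)).
apply: (@le_trans _ _ (expR (- (y ^+ 2 / 2)) * cosh s));
  first by rewrite ler_wpM2r.
have -> : cosh s = cosh s * expR (- (s ^+ 2 / 2)) * expR (s ^+ 2 / 2).
  by rewrite -mulrA -expRD addNr expR0 mulr1.
apply: (@le_trans _ _ (expR (- (y ^+ 2 / 2)) * (cosh x * expR (- (x ^+ 2 / 2))
  * expR (s ^+ 2 / 2)))).
  by rewrite ler_wpM2l ?expR_ge0// ler_wpM2r ?expR_ge0.
rewrite [leLHS]mulrC -!(mulrA (cosh x)) -!expRD ler_piMr//.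
by rewrite -[leRHS]expR0 ler_expR; lra.
Qed.

(** Squaring |w - cosh s| < sinh s and dividing by |w| turns it into
    cosh x < cos y cosh s, where x + iy = Log w. *)
Lemma Log_disk_cosh s w : 0 < s -> disk (cosh s)%:C (sinh s) w ->
  0 < Re w /\ disk 0 s (Log w).
Proof.
move=> s0 /diskE[sh0] /=; rewrite subr0 => h.
have cs := cosh_ge1 s; have cs2 := cosh2Bsinh2 s.
have m2 : Re w ^+ 2 + Im w ^+ 2 + 1 < 2 * Re w * cosh s by nra.
have w0 : 0 < Re w.
  have := sqr_ge0 (Re w); have := sqr_ge0 (Im w); nra.
split=> //; apply/diskE; split=> //; rewrite /= !subr0.
have wn0 : w != 0 by apply: contraTneq w0 => ->; rewrite ltxx.
have m0 := Re_norm_gt0 wn0; have yI := Arg_lt_pihalf w0.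
apply: (coshcos_lt s0 yI).
have Rew : Re w = Re `|w| * cos (Arg w) by rewrite [in LHS](Arg_polar wn0).
move: m2; rewrite -sqr_Re_norm Rew.
set m := Re `|w| in m0 *; move=> m2.
rewrite /cosh expRN lnK ?posrE// -/(cosh s) ltr_pdivrMr//.
rewrite -(ltr_pM2l m0) mulrDr divff ?gt_eqF// -expr2.
by apply: lt_le_trans m2 _; rewrite le_eqVlt; apply/orP; left; apply/eqP; ring.
Qed.

End Hyperbolic.

(** * Schlicht disks *)

Section Schlicht.
Variable R : realType.
Local Notation C := (R[i]^o).
Implicit Types (f : C -> C) (z w c : C) (r : R) (Omega : set C).

Lemma near_preimage (T U : topologicalType) (f : T -> U) x (A : set U) :
  {for x, continuous f} -> open A -> A (f x) -> nbhs x (f @^-1` A).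
Proof. by move=> fc Ao Ax; apply: fc; exact: open_nbhs_nbhs. Qed.

Lemma near_eq_continuous (T U : topologicalType) (f g : T -> U) x :
  {for x, continuous g} -> (\forall y \near x, g y = f y) ->
  {for x, continuous f}.
Proof.
move=> gc e; have ex := nbhs_singleton e.
rewrite /prop_for /continuous_at -ex; apply: cvg_trans gc.
by apply: near_eq_cvg; apply: filterS e => y ->.
Qed.

Lemma nbhs_disk z (N : set C) : nbhs z N -> exists2 r, 0 < r & disk z r `<=` N.
Proof.
move=> /nbhs_ballP[e /= e0 eN]; exists (Re e).
  by move: e0; rewrite ltcE => /andP[].
by rewrite /disk RRe_real// gtr0_real.
Qed.

Lemma connected_disk c r : connected (disk c r).
Proof.
pose seg z (t : R) : C := c + t%:C * (z - c).
have -> : disk c r = \bigcup_(z in disk c r) (seg z @` `[0, 1]).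
  apply/seteqP; split=> [z zD|_ [z /diskE[r0 zD] [t + <-]]]; rewrite /=.
    by exists z => //; exists 1;
      rewrite /= ?in_itv/= ?ler01 ?lexx// /seg mul1r addrC subrK.
  rewrite in_itv /= => /andP[t0 t1]; apply/diskE; split=> //.
  rewrite !ReImE /= !mul0r subr0 addr0 ![_ + _ * _ - _]addrAC !subrr !add0r
    !exprMn -mulrDr.
  apply: le_lt_trans zD.
  by rewrite ler_piMl ?addr_ge0 ?sqr_ge0// expr_le1.
apply: bigcup_connected.
  by exists c => z _; exists 0;
    rewrite /= ?in_itv/= ?ler01 ?lexx// /seg mul0r addr0.
move=> z _; apply: connected_continuous_connected;
  first exact: segment_connected.
apply: continuous_subspaceT => t.
have tc : {for t, continuous (fun t : R => t%:C : C)}.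
  by apply: continuous_ReIm => /=; [exact: cvg_id|exact: cvg_cst].
exact: (cvgD (cvg_cst _) (cvgM tc (cvg_cst _))).
Qed.

(** The region has to be the whole preimage of the disk.  It is the image of
    the disk under the inverse of f, which is continuous by [open_image]. *)
Lemma schlicht_disk_of_injective f Omega w r : open Omega ->
  (forall z, Omega z -> {for z, continuous f}) -> set_inj Omega f ->
  disk w r `<=` f @` Omega -> contains_schlicht_disk f Omega w r.
Proof.
move=> Oo fc fi sub; pose U := Omega `&` f @^-1` disk w r.
pose g v := get (Omega `&` [set z | f z = v]).
have gP v : disk w r v -> Omega (g v) /\ f (g v) = v.
  by move=> /sub [z Oz fz]; have :=
    @getPex _ (Omega `&` [set z | f z = v]) (ex_intro _ z (conj Oz fz)).
have gf z : Omega z -> disk w r (f z) -> g (f z) = z.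
  by move=> Oz /gP[ Og fg]; apply: fi; rewrite ?inE.
have UE : U = g @` disk w r.
  apply/seteqP; split=> [z [ Oz zD]|_ [v vD <-]];
    first by exists (f z) => //; exact: gf.
  by have [ Og fg] := gP _ vD; split=> //=; rewrite fg.
exists U; split.
- rewrite openE => z [ Oz zD].
  have nO : nbhs z Omega by exact: open_nbhs_nbhs.
  exact: (filterI nO (near_preimage (fc _ Oz) (@open_disk R w r) zD)).
- rewrite UE; apply: connected_continuous_connected;
    first exact: connected_disk.
  apply: continuous_in_subspaceT => v; rewrite inE => vD N Nn.
  have [ Og fg] := gP _ vD.
  have [s s0 sN] : exists2 s, 0 < s & disk (g v) s `<=` Omega `&` N.
    by apply: nbhs_disk; apply: filterI => //; exact: open_nbhs_nbhs.
  have [||d d0 dsub] := @open_image R f (g v) s s0.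
  + by move=> z /sN[ Oz _]; exact: fc.
  + by move=> z1 z2 /set_mem /sN [ Oz1 _] /set_mem /sN [ Oz2 _]; apply: fi;
      rewrite inE.
  have near1 : \forall u \near v, disk w r u.
    by apply: open_nbhs_nbhs; split=> //; exact: open_disk.
  have near2 := near_disk v d0.
  apply: filterS2 near1 near2 => v' v'D;
    rewrite -{1}fg => /dsub[z /sN[ Oz Nz] fz].
  by rewrite /= -fz gf// fz.
- by move=> z [].
- by move=> z1 z2 /set_mem [ Oz1 _] /set_mem [ Oz2 _]; apply: fi; rewrite inE.
- apply/seteqP; split=> [_ [z [_ zD] <-]//|v vD].
  by have [ Og fg] := gP _ vD; exists (g v) => //; split=> //=; rewrite fg.
Qed.

Lemma admissible_schlicht alpha (sigma rho : R) f :
  (0 < alpha)%N -> 0 < sigma -> rho <= 1 -> admissible alpha sigma rho f ->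
  contains_schlicht_disk f (disk 0 rho) (cosh sigma)%:C (sinh sigma).
Proof.
move=> a0 s0 r1 [[fn [/(_ 0%N a0)[/= Fc _ _ _] _]] f01 _ fi cover].
have sub z : disk 0 rho z -> disk 0 1 z.
  move=> /diskE[rho0]; rewrite /= !subr0 => h; apply/diskE; split=> //=.
  by rewrite !subr0 (lt_le_trans h)// ler_sqr ?nnegrE ?(ltW rho0).
have f0 z : disk 0 1 z -> f z != 0 by move=> /fn/eqP.
apply: schlicht_disk_of_injective => //; first exact: open_disk.
  move=> z /sub zD.
  have hc : {for z, continuous (fun z => cexp (Log (f z)))}.
    by apply: for_continuous_cexp; apply: Fc; rewrite inE.
  have e : \forall z' \near z, cexp (Log (f z')) = f z'.
    apply: filterS (open_nbhs_nbhs (conj (@open_disk R 0 1) zD)) => z' /f0.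
    exact: LogK.
  exact: near_eq_continuous hc e.
move=> w wD; have [w0 /cover[z zD /= Lz]] := Log_disk_cosh s0 wD.
exists z => //; apply: Log_inj => //; first exact/f0/sub.
by apply: contraTneq w0 => ->; rewrite ltxx.
Qed.

End Schlicht.

(** * Polynomials in z and its conjugate *)

Section PolynomialMaps.
Variable R : realType.
Local Notation C := (R[i]^o).
Implicit Types (f g : C -> C) (z v w d : C) (Q :
  {poly {poly R[i]}}) (Omega : set C).

Definition has_rderive f v z d : Prop :=
  is_derive (0 : R) (1 : R) (fun t : R => Re (f (z + t%:C * v)) : R^o) (Re d) /\
  is_derive (0 : R) (1 : R) (fun t : R => Im (f (z + t%:C * v)) : R^o) (Im d).

Lemma has_rderiveP f v z d : has_rderive f v z d ->
  rderivable f v z /\ rderive f v z = d.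
Proof.
move=> [[h1 h2] [h3 h4]]; split=> //; rewrite /rderive !derive1E h2 h4.
by case: (d).
Qed.

Lemma has_rderive_cst c v z : has_rderive (fun=> c) v z 0.
Proof. by split=> /=; exact: is_derive_cst. Qed.

Lemma has_rderive_id v z : has_rderive id v z v.
Proof.
split=> /=.
  under [X in is_derive _ _ X]eq_fun do rewrite !ReImE /= mul0r subr0.
  by apply: is_derive_eq; rewrite /GRing.scale /=; ring.
under [X in is_derive _ _ X]eq_fun do rewrite !ReImE /= mul0r addr0.
by apply: is_derive_eq; rewrite /GRing.scale /=; ring.
Qed.

Lemma Re_conjc (z : R[i]) : Re z^* = Re z. Proof. by case: z. Qed.
Lemma Im_conjc (z : R[i]) : Im z^* = - Im z. Proof. by case: z. Qed.

Lemma has_rderive_conj v z : has_rderive (fun z => z^*) v z v^*.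
Proof.
split=> /=.
  under [X in is_derive _ _ X]eq_fun do rewrite Re_conjc !ReImE /= mul0r subr0.
  by apply: is_derive_eq; rewrite Re_conjc /GRing.scale /=; ring.
under [X in is_derive _ _ X]eq_fun do rewrite Im_conjc !ReImE /= mul0r addr0.
by apply: is_derive_eq; rewrite Im_conjc /GRing.scale /=; ring.
Qed.

Lemma has_rderiveD f g v z d d' : has_rderive f v z d -> has_rderive g v z d' ->
  has_rderive (fun z => f z + g z) v z (d + d').
Proof.
move=> [h1 h2] [h3 h4]; split.
  under [X in is_derive _ _ X]eq_fun do rewrite Re_add.
  by rewrite Re_add; exact: is_deriveD.
under [X in is_derive _ _ X]eq_fun do rewrite Im_add.
by rewrite Im_add; exact: is_deriveD.
Qed.

Lemma has_rderiveM f g v z d d' : has_rderive f v z d -> has_rderive g v z d' ->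
  has_rderive (fun z => f z * g z) v z (f z * d' + d * g z).
Proof.
move=> [h1 h2] [h3 h4]; split.
  under [X in is_derive _ _ X]eq_fun do rewrite Re_mul.
  by apply: is_derive_eq; rewrite mul0r addr0 !ReImE /GRing.scale /=; ring.
under [X in is_derive _ _ X]eq_fun do rewrite Im_mul.
by apply: is_derive_eq; rewrite mul0r addr0 !ReImE /GRing.scale /=; ring.
Qed.

(** The inner variable stands for z and the outer one for its conjugate. *)
Definition ev Q z : C := Q.[(z^*)%:P].[z].

Lemma evD Q Q' z : ev (Q + Q') z = ev Q z + ev Q' z.
Proof. by rewrite /ev !hornerD. Qed.

Lemma evM Q Q' z : ev (Q * Q') z = ev Q z * ev Q' z.
Proof. by rewrite /ev !hornerM. Qed.

Lemma evC (p : {poly R[i]}) z : ev p%:P z = p.[z].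
Proof. by rewrite /ev hornerC. Qed.

Lemma evX z : ev 'X z = z^*.
Proof. by rewrite /ev hornerX hornerC. Qed.

Lemma has_rderive_horner (p : {poly R[i]}) v z :
  has_rderive (fun z => p.[z]) v z (v * p^`().[z]).
Proof.
elim/poly_ind: p => [|p c IH].
  rewrite deriv0 horner0 mulr0; under eq_fun do rewrite horner0.
  exact: has_rderive_cst.
under eq_fun do rewrite hornerMXaddC.
have := has_rderiveD (has_rderiveM IH (has_rderive_id v z)) (has_rderive_cst c
  v z).
congr has_rderive; rewrite derivMXaddC hornerD hornerMX /=; ring.
Qed.

(** Qz is the formal derivative in the inner variable; v and its conjugate
    appear because the conjugate of z + t v moves with velocity the conjugate
    of v. *)
Lemma has_rderive_ev Q : exists Qz, forall v z,
  has_rderive (ev Q) v z (v * ev Qz z + v^* * ev Q^`() z).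
Proof.
elim/poly_ind: Q => [|Q c [Qz IH]].
  exists 0 => v z; rewrite deriv0 (_ : ev 0 = fun=> 0); last first.
    by apply/funext => w; rewrite /ev !horner0.
  by rewrite !mulr0 addr0; exact: has_rderive_cst.
exists (Qz * 'X + (c^`())%:P) => v z.
rewrite (_ : ev (Q * 'X + c%:P) = fun z => ev Q z * z^* + c.[z]); last first.
  by apply/funext => w; rewrite evD evM evX evC.
have := has_rderiveD (has_rderiveM (IH v z) (has_rderive_conj v z))
  (has_rderive_horner c v z).
congr has_rderive; rewrite derivMXaddC !evD !evM !evX evC /=; ring.
Qed.

Lemma conj_one : (1 : C)^* = 1 :> C.
Proof. exact: conjc1. Qed.

Lemma conj_i : ('i%C : C)^* = - 'i%C :> C.
Proof. by apply: complex_ext; rewrite /= ?oppr0. Qed.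

(** With a and b the formal derivatives in z and its conjugate, the numerator
    is the x-derivative plus i times the y-derivative. *)
Lemma wirtinger (a b : R[i]) :
  (1 * a + 1 * b + 'i%C * ('i%C * a + - 'i%C * b)) / 2%:R = b.
Proof.
have n2 : 2%:R != 0 :> R[i] by rewrite pnatr_eq0.
rewrite (_ : _ + _ = b * 2%:R) ?mulfK//.
by rewrite mulrDr !mulrA mulrN -expr2 sqr_i; ring.
Qed.

Lemma dzbar_ev Q : dzbar (ev Q) = ev Q^`().
Proof.
have [Qz h] := has_rderive_ev Q; apply/funext => z.
rewrite /dzbar /dx /dy; have [_ ->] := has_rderiveP (h 1 z).
have [_ ->] := has_rderiveP (h 'i%C z).
by rewrite conj_one conj_i; exact: wirtinger.
Qed.

Lemma iter_dzbar_ev k Q : iter k (@dzbar R) (ev Q) = ev Q^`(k).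
Proof.
by elim: k => [|k IH]; [rewrite derivn0|rewrite iterS IH dzbar_ev derivnS].
Qed.

Lemma continuous_ev Q : continuous (ev Q).
Proof.
have cid : continuous (id : C -> C) by move=> z; exact: cvg_id.
have cr : continuous (fun z : C => Re z^*).
  rewrite (_ : (fun z : C => Re z^*) = @complex.Re R);
    first exact: continuous_Re.
  by apply/funext => w; rewrite Re_conjc.
have ci : continuous (fun z : C => Im z^*).
  rewrite (_ : (fun z : C => Im z^*) = (fun z : C => - Im z)); last first.
    by apply/funext => w; rewrite Im_conjc.
  by move=> z; exact: (cvgN (for_continuous_Im (cid z))).
have conjc_cont : continuous (fun z : C => z^* : C).
  by move=> z; apply: continuous_ReIm; [exact: cr|exact: ci].
have ch (p : {poly R[i]}) : continuous (fun z : C => p.[z] : C).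
  elim/poly_ind: p => [|p c IH].
    rewrite (_ : (fun z : C => _) = (fun=> (0 : C)));
      first exact: cst_continuous.
    by apply/funext => w; rewrite horner0.
  rewrite (_ : (fun z : C => _) = (fun z : C => (p.[z] : C) * z + (c : C)));
    last first.
    by apply/funext => w; rewrite hornerMXaddC.
  by move=> z; exact: (cvgD (cvgM (IH z) (cid z)) (cvg_cst _)).
elim/poly_ind: Q => [|Q c IH].
  rewrite (_ : ev 0 = (fun=> (0 : C))); first exact: cst_continuous.
  by apply/funext => w; rewrite /ev !horner0.
rewrite (_ : ev (Q * 'X + c%:P) = fun z => ev Q z * z^* + c.[z]); last first.
  by apply/funext => w; rewrite evD evM evX evC.
by move=> z; exact: (cvgD (cvgM (IH z) (conjc_cont z)) (ch c z)).
Qed.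

Lemma C1_on_ev Q Omega : C1_on Omega (ev Q).
Proof.
have [Qz h] := has_rderive_ev Q; split.
- by move=> z _; exact: continuous_ev.
- move=> z _; have [h1 _] := has_rderiveP (h 1 z).
  by have [h2 _] := has_rderiveP (h 'i%C z).
- move=> z _; rewrite (_ : dx _ = ev (Qz + Q^`())); first exact: continuous_ev.
  apply/funext => w; rewrite /dx; have [_ ->] := has_rderiveP (h 1 w).
  by rewrite conj_one !mul1r evD.
- move=> z _; rewrite (_ : dy _ = ev (('i%C)%:P%:P * (Qz - Q^`())));
    first exact: continuous_ev.
  apply/funext => w; rewrite /dy; have [_ ->] := has_rderiveP (h 'i%C w).
  rewrite conj_i evM evC hornerC.
  by rewrite /ev !hornerD !hornerN; ring.
Qed.

Lemma polyanalytic_ev alpha Q Omega : (size Q <= alpha)%N ->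
  polyanalytic alpha Omega (ev Q).
Proof.
move=> sQ; split=> [k _|z _]; rewrite iter_dzbar_ev; first exact: C1_on_ev.
by rewrite derivn_poly0// /ev !horner0.
Qed.

Section Locality.
Variable Omega : set C.
Hypothesis Omega_open : open Omega.

Let near_line v z : Omega z -> \forall t \near (0 : R), Omega (z + t%:C * v).
Proof.
move=> Oz; have tc : {for (0 : R), continuous (fun t : R => t%:C : C)}.
  by apply: continuous_ReIm => /=; [exact: cvg_id|exact: cvg_cst].
have lc : {for (0 : R), continuous (fun t : R => z + t%:C * v : C)}.
  exact: (cvgD (cvg_cst _) (cvgM tc (cvg_cst _))).
by apply: (near_preimage lc Omega_open); rewrite mul0r addr0.
Qed.

(** Log o f agrees with a polynomial map on the unit disk only, so that the
    differential conditions have to be transported along equality on an open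
    set. *)
Lemma rderivable_eq f g v z : (forall w, Omega w -> f w = g w) -> Omega z ->
  rderivable f v z -> rderivable g v z.
Proof.
move=> fg Oz [h1 h2]; split.
  by apply: near_eq_derivable h1; apply: filterS (near_line v Oz) => t /fg ->.
by apply: near_eq_derivable h2; apply: filterS (near_line v Oz) => t /fg ->.
Qed.

Lemma rderive_eq f g v z : (forall w, Omega w -> f w = g w) -> Omega z ->
  rderive f v z = rderive g v z.
Proof.
move=> fg Oz; rewrite /rderive !derive1E.
congr (_ +i* _); apply: near_eq_derive.
  by apply: filterS (near_line v Oz) => t /fg ->.
by apply: filterS (near_line v Oz) => t /fg ->.
Qed.

Lemma continuous_in_eq f g : (forall w, Omega w -> f w = g w) ->
  {in Omega, continuous f} -> {in Omega, continuous g}.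
Proof.
move=> fg fc z Oz; apply: near_eq_continuous (fc z Oz) _.
by apply: filterS (open_nbhs_nbhs (conj Omega_open (set_mem Oz))) => w /fg.
Qed.

Lemma C1_on_eq f g : (forall w, Omega w -> f w = g w) ->
  C1_on Omega f -> C1_on Omega g.
Proof.
move=> fg [h1 h2 h3 h4]; split.
- exact: continuous_in_eq h1.
- by move=> z Oz; have [a b] := h2 z Oz; split; exact: rderivable_eq fg Oz _.
- by apply: continuous_in_eq h3 => w Ow; exact: rderive_eq.
- by apply: continuous_in_eq h4 => w Ow; exact: rderive_eq.
Qed.

Lemma polyanalytic_eq alpha f g : (forall w, Omega w -> f w = g w) ->
  polyanalytic alpha Omega f -> polyanalytic alpha Omega g.
Proof.
move=> fg [h1 h2].
have it k w : Omega w -> iter k (@dzbar R) f w = iter k (@dzbar R) g w.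
  elim: k w => [|k IH] w Ow /=; first exact: fg.
  by rewrite /dzbar /dx /dy !(rderive_eq _ IH Ow).
split=> [k /h1|z Oz]; first by apply: C1_on_eq => w; exact: it.
by rewrite -it// h2.
Qed.

End Locality.

End PolynomialMaps.

(** * A criterion for sharpness *)

Section RadiusFails.
Variable R : realType.
Local Notation C := (R[i]^o).
Implicit Types (F : C -> C) (z v d : C).

Lemma has_rderive_cexp F v z d : F z = 0 -> has_rderive F v z d ->
  has_rderive (fun z => cexp (F z)) v z d.
Proof.
move=> Fz [h1 h2].
have F0 : F (z + (0 : R)%:C * v) = 0 by rewrite mul0r addr0.
split; apply: is_derive_eq; rewrite F0 /= expR0 cos0 sin0 /GRing.scale /=; ring.
Qed.

Lemma normC_real (x : R) : `|x%:C| = `|x|%:C :> R[i].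
Proof. by rewrite normc_def /= expr0n addr0 sqrtr_sqr. Qed.

(** At 0 the map F = ev Q has x-derivative 1 and y-derivative i B, hence
    lambda = (1 + B) / 2 - (B - 1) / 2 = 1.  The bound on Im F makes F the
    principal logarithm of exp F; the point of the enlarged disk that
    exp F omits is exp sigma. *)
Lemma radius_fails_of_poly alpha (sigma rho r B : R) (Q : {poly {poly R[i]}}) :
  (size Q <= alpha)%N -> 0 < sigma -> 0 < rho <= 1 -> 1 <= B ->
  (forall z, disk 0 1 z -> - pi < Im (ev Q z) <= pi) ->
  ev Q 0 = 0 -> has_rderive (ev Q) 1 0 1 ->
    has_rderive (ev Q) 'i%C 0 ('i%C * B%:C) ->
  set_inj (disk 0 rho) (ev Q) ->
  (forall rho', rho < rho' <= 1 -> ~ set_inj (disk 0 rho') (ev Q)) ->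
  disk 0 sigma `<=` ev Q @` disk 0 rho ->
  ~ (ev Q @` disk 0 rho) sigma%:C ->
  sinh sigma < r -> radius_fails alpha sigma rho r.
Proof.
move=> sQ s0 /andP[r0 r1] B1 Im1 Q0 dQ1 dQi inj ninj cover miss sr.
pose f z := cexp (ev Q z).
have sub (r' : R) z : r' <= 1 -> disk 0 r' z -> disk 0 1 z.
  move=> r'1 /diskE[r'0]; rewrite /= !subr0 => h; apply/diskE; split=> //=.
  by rewrite !subr0 (lt_le_trans h)// ler_sqr ?nnegrE ?(ltW r'0).
have Lf z : disk 0 1 z -> Log (f z) = ev Q z by move=> /Im1; exact: cexpK.
have f0 : f 0 = 1.
  by rewrite /f Q0; apply: complex_ext;
    rewrite /= expR0 ?cos0 ?sin0 ?mulr1 ?mulr0.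
exists f; split.
- split=> //.
  + split; first by move=> z _; apply/eqP; exact: cexp_neq0.
    apply: (polyanalytic_eq (@open_disk R 0 1) _ (polyanalytic_ev (disk 0 1)
      sQ)).
    by move=> z /Lf /= ->.
  + have [_ d1] := has_rderiveP (has_rderive_cexp Q0 dQ1).
    have [_ d2] := has_rderiveP (has_rderive_cexp Q0 dQi).
    rewrite /lambda /dz /dzbar /dx /dy d1 d2.
    have -> : (1 - 'i%C * ('i%C * B%:C)) / 2%:R = ((1 + B) / 2)%:C :> R[i].
      rewrite mulrA -expr2 sqr_i mulN1r opprK rmorphM rmorphD /= rmorph1.
      by rewrite fmorphV rmorph_nat.
    have -> : (1 + 'i%C * ('i%C * B%:C)) / 2%:R = ((1 - B) / 2)%:C :> R[i].
      rewrite mulrA -expr2 sqr_i mulN1r rmorphM rmorphB /= rmorph1.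
      by rewrite fmorphV rmorph_nat.
    rewrite !normC_real -rmorphB normC_real (@ger0_norm _ ((1 + B) / 2));
      last by lra.
    rewrite (@ler0_norm _ ((1 - B) / 2)); last by lra.
    by rewrite (_ : _ - _ = 1) ?normr1//; field.
  + move=> z1 z2 z1D z2D fz; apply: inj => //.
    by rewrite -!Lf ?fz//; apply: sub r1 _; exact: set_mem.
  + move=> w /cover[z zD zw]; exists z => //=.
    by rewrite Lf//; exact: sub zD.
- split=> [z1 z2 z1D z2D fz|rho' /andP[r'0 r'1] inj'].
    apply: inj => //; rewrite -!Lf ?fz//; by apply: sub r1 _; exact: set_mem.
  rewrite leNgt; apply/negP => rr'; apply: (ninj rho'); first by rewrite rr'.
  move=> z1 z2 z1D z2D Qz; apply: inj' => //.
  by rewrite /f Qz.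
- move=> [U [_ _ UD _ fU]].
  have : disk (cosh sigma)%:C r (cexp sigma%:C).
    have sh := sinh_ge0 (ltW s0); have r00 := le_lt_trans sh sr.
    apply/diskE; split=> //=.
    rewrite cos0 sin0 mulr1 mulr0 subr0 expr0n addr0.
    rewrite (_ : _ - _ = sinh sigma); last by rewrite /cosh /sinh; field.
    by rewrite ltr_sqr ?nnegrE// ltW.
  rewrite -fU => -[z /UD zD fz]; apply: miss; exists z => //.
  rewrite -Lf; last exact: sub zD.
  by rewrite fz cexpK//= oppr_lt0 pi_gt0 pi_ge0.
Qed.

Lemma radius_fails_unit alpha (r : R) : (0 < alpha)%N -> sinh 1 < r ->
  radius_fails alpha (1 : R) (1 : R) r.
Proof.
move=> a0 r1; pose Q : {poly {poly R[i]}} := 'X%:P.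
have QE z : ev Q z = z by rewrite evC hornerX.
have QE' : ev Q = id by apply/funext.
apply: (@radius_fails_of_poly alpha 1 1 r 1 Q) => //; rewrite ?QE' //.
- by rewrite size_polyC polyX_eq0.
- by rewrite ltr01 lexx.
- move=> z /diskE[_]; rewrite /= !subr0 expr1n => h.
  have pi1 := pi_ge2 R; have h1 : Im z ^+ 2 < 1 ^+ 2.
    by rewrite expr1n (le_lt_trans _ h)// lerDr sqr_ge0.
  have : `|Im z| < 1 by rewrite -ltr_sqr ?nnegrE// real_normK ?num_real.
  rewrite ltr_norml => /andP[h2 h3]; apply/andP; split; lra.
- exact: has_rderive_id.
- rewrite mulr1; exact: has_rderive_id.
- by move=> rho' /andP[h1 h2]; move: (lt_le_trans h1 h2); rewrite ltxx.
- by rewrite image_id.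
- rewrite image_id => /diskE[_] /=.
  by rewrite !subr0 expr0n addr0 ltxx.
Qed.

End RadiusFails.

(** * The two profiles of the extremal map *)

Section Profiles.
Variable R : realType.
Implicit Types (x y t : R).

Lemma derive_gt0_lt (f f' : R -> R) (a b : R) :
  (forall t, is_derive t (1 : R) f (f' t)) -> a < b ->
  (forall t, a < t < b -> 0 < f' t) -> f a < f b.
Proof.
move=> fd b0 f'0; have fd1 t : derivable f t 1 by have [] := fd t.
apply: (@gtr0_derive1_incr R f a b) => //.
- move=> t; rewrite in_itv /= => /f'0.
  by rewrite derive1E; have [_ ->] := fd t.
- apply: continuous_subspaceT => t; apply: differentiable_continuous.
  exact/derivable1_diffP.
Qed.

Lemma is_derive_continuous (f f' : R -> R) :
  (forall t, is_derive t (1 : R) f (f' t)) -> continuous f.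
Proof.
move=> fd t; have [fd1 _] := fd t.
by apply: differentiable_continuous; exact/derivable1_diffP.
Qed.

Lemma is_derive_pow (f : R -> R) t d n : is_derive t (1 : R) f d ->
  is_derive t (1 : R) (fun y => f y ^+ n.+1) (n.+1%:R * f t ^+ n * d).
Proof.
move=> fd; have := is_deriveX n.+1 fd; congr is_derive.
by apply/funext => y; rewrite exprfctE.
Qed.

(** Normalize the critical points of y (1 - a y^2)^N, with N = n + 1, to be
    y = rho and y = - rho: the derivative is (1 - a y^2)^n (1 - y^2 / rho^2)
    when a = 1 / ((2 N + 1) rho^2), and a large n makes a < 1, so that no other
    critical point occurs between -1 and 1.  The height 3/2 could be any number
    strictly between 1 and pi. *)
Lemma exists_bump (rho : R) : 0 < rho <= 1 ->
  exists n (a B : R), let v := fun y => B * y * (1 - a * y ^+ 2) ^+ n.+1 in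
  [/\ 1 <= B, is_derive (0 : R) (1 : R) v B /\ v rho = 3 / 2,
      forall x y, - rho <= x -> x < y -> y <= rho -> v x < v y,
      forall y, -1 <= y <= 1 -> `|v y| <= 3 / 2
    & forall s, rho < s <= 1 -> exists x y, [/\ 0 <= x, x < y, y < s & v x = v
      y]].
Proof.
move=> /andP[r0 r1].
(* n rho^2 > 1 is what makes a < 1. *)
have [n hn] : exists n : nat, (rho ^+ 2)^-1 < n%:R.
  by exists (Num.bound (rho ^+ 2)^-1); apply: archi_boundP;
    rewrite invr_ge0 sqr_ge0.
pose M : R := n%:R *+ 2 + 3; have n0 : 0 <= n%:R :> R by rewrite ler0n.
have M0 : 0 < M by rewrite /M; lra.
have r2 : 0 < rho ^+ 2 by rewrite exprn_gt0.
pose a := (M * rho ^+ 2)^-1.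
have a0 : 0 < a by rewrite invr_gt0 mulr_gt0.
have Mr : 1 < n%:R * rho ^+ 2 by rewrite -ltr_pdivrMr// mul1r.
have a1 : a < 1.
  rewrite invf_lt1 ?mulr_gt0//; apply: lt_le_trans Mr _.
  by rewrite ler_wpM2r ?(ltW r2)// /M; lra.
have ar : a * rho ^+ 2 = M^-1 by rewrite /a invfM divfK ?gt_eqF.
have M1 : M^-1 < 1 by rewrite invf_lt1//; rewrite /M; lra.
have q0 y : -1 <= y <= 1 -> 0 < 1 - a * y ^+ 2.
  move=> /andP[y1 y2]; have y21 : y ^+ 2 <= 1 by nra.
  have y20 := sqr_ge0 y; nra.
have D0 : 0 < rho * (1 - a * rho ^+ 2) ^+ n.+1.
  by rewrite mulr_gt0// exprn_gt0// ar; lra.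
pose B := 3 / 2 / (rho * (1 - a * rho ^+ 2) ^+ n.+1).
have B0 : 0 < B by rewrite divr_gt0// divr_gt0.
have B1 : 1 <= B.
  rewrite ler_pdivlMr// mul1r.
  have p1 : 1 - a * rho ^+ 2 <= 1 by rewrite gerBl mulr_ge0 ?ltW.
  have p0 : 0 <= 1 - a * rho ^+ 2 by rewrite ar; lra.
  have : rho * (1 - a * rho ^+ 2) ^+ n.+1 <= 1.
    by rewrite mulr_ile1 ?exprn_ge0 ?exprn_ile1 ?(ltW r0).
  by lra.
pose v y := B * y * (1 - a * y ^+ 2) ^+ n.+1.
pose v' y := B * (1 - a * y ^+ 2) ^+ n * (1 - y ^+ 2 / rho ^+ 2).
have vd t : is_derive t (1 : R) v (v' t).
  have d1 : is_derive t (1 : R) (fun y => 1 - a * y ^+ 2) (- (a * (2 * t))).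
    by apply: is_derive_eq; rewrite /GRing.scale /=; ring.
  have d2 : is_derive t (1 : R) (fun y => B * y) B.
    by apply: is_derive_eq; rewrite /GRing.scale /=; ring.
  have d3 := is_deriveM d2 (is_derive_pow n d1).
  apply: (is_derive_eq d3); rewrite /v' /GRing.scale /= [_ ^+ n.+1]exprS
    -(natr1 n).
  rewrite (_ : t ^+ 2 / rho ^+ 2 = M * (a * t ^+ 2)); last first.
    by rewrite /a invfM; field; rewrite !gt_eqF.
  rewrite /M; ring.
have vc : continuous v by exact: is_derive_continuous vd.
have vr : v rho = 3 / 2 by rewrite /v -mulrA /B divfK// gt_eqF.
have vpos y : 0 <= y <= 1 -> 0 <= v y.
  move=> /andP[y0 y1]; apply: mulr_ge0; first by rewrite mulr_ge0// ltW.
  by rewrite exprn_ge0// ltW// q0// y1 (le_trans _ y0)// lerN10.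
have v'E t : -1 <= t <= 1 -> exists2 q, 0 < q & v' t = q * (rho ^+ 2 - t ^+ 2).
  move=> tI; exists (B * (1 - a * t ^+ 2) ^+ n / rho ^+ 2).
    by rewrite divr_gt0// mulr_gt0// exprn_gt0// q0.
  by rewrite /v'; field; rewrite gt_eqF.
have vincr x y : - rho <= x -> x < y -> y <= rho -> v x < v y.
  move=> rx xy yr; apply: (derive_gt0_lt vd xy) => t /andP[xt ty].
  have [|q q0' ->] := v'E t; first by apply/andP; split; lra.
  by rewrite mulr_gt0//; nra.
have vmax y : 0 <= y <= 1 -> v y <= 3 / 2.
  move=> /andP[y0 y1]; have [yr|ry] := leP y rho; rewrite -vr.
    move: yr; rewrite le_eqVlt => /orP[/eqP->//|yr]; apply/ltW/vincr => //; lra.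
  rewrite -lerN2; have vdN t : is_derive t (1 : R) (fun y => - v y) (- v' t).
    exact: is_deriveN.
  apply: (derive_ge0_le vdN (ltW ry)) => t /andP[xt ty].
  have [|q q0' ->] := v'E t; first by apply/andP; split; lra.
  by rewrite oppr_ge0 mulr_ge0_le0// ?(ltW q0'); nra.
have vN y : v (- y) = - v y by rewrite /v sqrrN mulrN mulNr.
have vabs y : -1 <= y <= 1 -> `|v y| <= 3 / 2.
  wlog y0 : y / 0 <= y.
    move=> h; have [/h//|y0 /andP[y1 y2]] := leP 0 y.
    by rewrite -normrN -vN; apply: h; lra.
  move=> /andP[_ y1]; have yI : 0 <= y <= 1 by rewrite y0.
  by rewrite ger0_norm ?vmax// vpos.
exists n, a, B; split => //.
  split=> //; have := vd 0; congr is_derive.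
  by rewrite /v' !expr0n mulr0 mul0r subr0 expr1n !mulr1.
move=> s /andP[rs s1].
pose y := (rho + s) / 2.
have yI : 0 <= y <= 1 by apply/andP; split; rewrite /y; lra.
have [] := @IVT R v 0 rho (v y) (ltW r0) (continuous_subspaceT vc).
  have v0 : v 0 = 0 by rewrite /v mulr0 mul0r.
  rewrite v0 vr ge_min le_max vpos//= vmax ?orbT//.
move=> x; rewrite in_itv /= => /andP[x0 xr] vx; exists x, y; split => //;
  rewrite /y; lra.
Qed.

(** The function (1 - (1 - x)^(k + 1)) / (k + 1) with even k is increasing,
    has slope 1 at 0 and stays below 1 / (k + 1) <= sigma for 0 <= x <= 1;
    a cubic term then adjusts its value at rho without changing the slope
    at 0. *)
Lemma exists_profile (sigma rho : R) : 0 < sigma -> 0 < rho <= 1 ->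
  exists k (c L : R),
    let u := fun x => (1 - (1 - x) ^+ k.+1) / k.+1%:R + c * x ^+ 3 in
  [/\ 0 <= L, is_derive (0 : R) (1 : R) u 1,
      forall x y, x < y -> y <= 1 -> u x < u y,
      u rho = sigma
    & forall s, 0 <= s <= rho ->
      sigma - u s <= L * (rho - s) /\ u (- s) <= - u s].
Proof.
move=> s0 /andP[r0 r1].
have [m hm] : exists m : nat, sigma^-1 < m%:R.
  by exists (Num.bound sigma^-1); apply: archi_boundP; rewrite invr_ge0 ltW.
pose k := m.*2; have k0 : 0 < k.+1%:R :> R by rewrite ltr0n.
have r3 : 0 < rho ^+ 3 by rewrite exprn_gt0.
have p0 : 0 <= (1 - rho) ^+ k.+1 by rewrite exprn_ge0// subr_ge0.
pose c := (sigma - (1 - (1 - rho) ^+ k.+1) / k.+1%:R) / rho ^+ 3.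
have c0 : 0 <= c.
  rewrite divr_ge0 ?(ltW r3)// subr_ge0 ler_pdivrMr//.
  have : 1 < sigma * m%:R by rewrite -ltr_pdivrMl// mulr1.
  have : m%:R <= k.+1%:R :> R by rewrite ler_nat /k -addnn -addSn leq_addl.
  nra.
pose u x := (1 - (1 - x) ^+ k.+1) / k.+1%:R + c * x ^+ 3.
pose u' x := (1 - x) ^+ k + 3 * c * x ^+ 2.
have ud t : is_derive t (1 : R) u (u' t).
  have d1 : is_derive t (1 : R) (fun x => 1 - x) (- 1).
    by apply: is_derive_eq; rewrite /GRing.scale /=; ring.
  have d2 := is_derive_pow k d1.
  have d3 : is_derive t (1 : R) (fun x => c * x ^+ 3) (3 * c * t ^+ 2).
    by apply: is_derive_eq; rewrite /GRing.scale /=; ring.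
  have d4 : is_derive t (1 : R) (fun x => k.+1%:R^-1 * (1 - (1 - x) ^+ k.+1))
    ((1 - t) ^+ k).
    by apply: is_derive_eq; rewrite /GRing.scale /=; field; rewrite gt_eqF.
  have := is_deriveD d4 d3; congr is_derive.
  by apply/funext => x; rewrite /u [_ / _]mulrC.
have ur : u rho = sigma by rewrite /u /c divfK ?gt_eqF// addrC subrK.
exists k, c, (1 + 3 * c); split => //.
- by lra.
- by have := ud 0; congr is_derive; rewrite /u' subr0 expr1n expr0n mulr0 addr0.
- move=> x y xy y1; apply: (derive_gt0_lt ud xy) => t /andP[_ ty].
  apply: ltr_pwDl; first by rewrite exprn_gt0// subr_gt0 (lt_le_trans ty).
  by rewrite mulr_ge0 ?sqr_ge0// mulr_ge0.
move=> s /andP[s0' sr]; split.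
  rewrite -/(u s) -ur -subr_ge0.
  have gd t : is_derive t (1 :
    R) (fun x => (1 + 3 * c) * x - u x) ((1 + 3 * c) - u' t).
    have d1 : is_derive t (1 : R) (fun x => (1 + 3 * c) * x) (1 + 3 * c).
      by apply: is_derive_eq; rewrite /GRing.scale /=; ring.
    exact: is_deriveB.
  have := derive_ge0_le gd sr; rewrite /= => h.
  have : forall t : R, s < t < rho -> 0 <= 1 + 3 * c - u' t.
    move=> t /andP[st tr]; rewrite /u'.
    have : (1 - t) ^+ k <= 1 by rewrite exprn_ile1//; lra.
    have : t ^+ 2 <= 1 by nra.
    nra.
  by move=> /h; lra.
have hd t : is_derive t (1 : R)
    (fun x => k.+1%:R^-1 * ((1 + x) ^+ k.+1 + (1 - x) ^+ k.+1 - 2)) ((1 + t)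
      ^+ k - (1 - t) ^+ k).
  have d1 : is_derive t (1 : R) (fun x => 1 - x) (- 1).
    by apply: is_derive_eq; rewrite /GRing.scale /=; ring.
  have d2 : is_derive t (1 : R) (fun x => 1 + x) 1.
    by apply: is_derive_eq; rewrite /GRing.scale /=; ring.
  have d1' := is_derive_pow k d1; have d2' := is_derive_pow k d2.
  by apply: is_derive_eq; rewrite /GRing.scale /=; field; rewrite gt_eqF.
have := derive_ge0_le hd s0'; rewrite addr0 subr0 expr1n.
rewrite (_ : 1 + 1 - 2 = 0 :> R) ?mulr0; last by ring.
move=> h; rewrite -/(u s) -/(u (- s)) -subr_ge0.
have -> : - u s - u (- s) =
    k.+1%:R^-1 * ((1 + s) ^+ k.+1 + (1 - s) ^+ k.+1 - 2).
  rewrite /u opprK; move: ((1 + s) ^+ k.+1) ((1 - s) ^+ k.+1) => p q.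
  by move: (k.+1%:R^-1) => i; ring.
apply: h => t /andP[t0 ts]; rewrite subr_ge0 lerXn2r ?nnegrE//; lra.
Qed.

End Profiles.

(** * The extremal map *)

Section Example.
Variable R : realType.
Local Notation C := (R[i]^o).
Implicit Types (z : C) (Q : {poly {poly R[i]}}) (x y t : R).

Definition cstQ (x : R) : {poly {poly R[i]}} := (x%:C)%:P%:P.
Definition ReQ : {poly {poly R[i]}} := cstQ 2^-1 * ('X%:P + 'X).
Definition ImQ : {poly {poly R[i]}} :=
  (- 'i%C)%:P%:P * (cstQ 2^-1 * ('X%:P - 'X)).

Lemma evB Q Q' z : ev (Q - Q') z = ev Q z - ev Q' z.
Proof. by rewrite /ev !hornerD !hornerN. Qed.

Lemma ev_exp Q n z : ev (Q ^+ n) z = ev Q z ^+ n.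
Proof. by rewrite /ev !horner_exp. Qed.

Lemma ev1 z : ev 1 z = 1.
Proof. by rewrite /ev !hornerC. Qed.

Lemma ev_cst x z : ev (cstQ x) z = x%:C.
Proof. by rewrite evC hornerC. Qed.

Lemma ev_ReQ z : ev ReQ z = (Re z)%:C.
Proof.
rewrite evM ev_cst evD evC evX hornerX; apply: complex_ext.
  by rewrite !ReImE Re_conjc /=; field.
by rewrite !ReImE Im_conjc /=; field.
Qed.

Lemma ev_ImQ z : ev ImQ z = (Im z)%:C.
Proof.
rewrite evM evC hornerC evM ev_cst evB evC evX hornerX; apply: complex_ext.
  by rewrite !ReImE Re_conjc Im_conjc /=; field.
by rewrite !ReImE Re_conjc Im_conjc /=; field.
Qed.

Lemma realCD x y : (x + y)%:C = x%:C + y%:C :> R[i].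
Proof. exact: rmorphD. Qed.

Lemma realCB x y : (x - y)%:C = x%:C - y%:C :> R[i].
Proof. exact: rmorphB. Qed.

Lemma realCM x y : (x * y)%:C = x%:C * y%:C :> R[i].
Proof. exact: rmorphM. Qed.

Lemma realCX x n : (x ^+ n)%:C = x%:C ^+ n :> R[i].
Proof. exact: rmorphXn. Qed.

Definition realC_E := (realCB, realCD, realCM, realCX).

Lemma ev_example (P1 P2 P3 P4 P5 I X Y : {poly {poly R[i]}}) z
    (p1 p2 p3 p4 p5 x y : R) k n :
  ev P1 z = p1%:C -> ev P2 z = p2%:C -> ev P3 z = p3%:C -> ev P4 z = p4%:C ->
  ev P5 z = p5%:C -> ev I z = 'i%C -> ev X z = x%:C -> ev Y z = y%:C ->
  ev (P1 * (1 - (1 - X) ^+ k) + P2 * X ^+ 3 + P3 * X * Y ^+ 2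
      + I * (P4 * Y * (1 - P5 * Y ^+ 2) ^+ n)) z =
  (p1 * (1 - (1 - x) ^+ k) + p2 * x ^+ 3 + p3 * x * y ^+ 2)
    +i* (p4 * y * (1 - p5 * y ^+ 2) ^+ n).
Proof.
move=> h1 h2 h3 h4 h5 hI hX hY; rewrite [RHS]complexE /=.
rewrite !(evB, evD, evM, ev_exp, ev1) h1 h2 h3 h4 h5 hI hX hY.
by rewrite !realC_E.
Qed.

(** To reach a point X + iY of the disk of radius sigma, solve v(y) = Y first:
    as |Y| < 1 < 3/2, the solution has |y| < y0 with y0 < rho independent of
    Y.  The horizontal chord of the disk of radius rho at height y has
    half-length s >= x0 > 0, and rho - s is of the order of y^2, so that a
    large K gives u(s) + K s y^2 >= sigma > |X|; then solve in x along the
    chord. *)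
Lemma radius_fails_exists (sigma rho r : R) :
  0 < sigma <= 1 -> 0 < rho <= 1 -> sinh sigma < r ->
  exists alpha : nat, (0 < alpha)%N /\ radius_fails alpha sigma rho r.
Proof.
move=> /andP[s0 s1] rhoI sr; have /andP[r0 r1] := rhoI.
have [n [a [B]]] := exists_bump rhoI.
set v := (fun y => B * y * (1 - a * y ^+ 2) ^+ n.+1);
  move=> /= [B1 [v'0 vr] vincr vmax vbump].
have [k [c [L]]] := exists_profile s0 rhoI.
set u := (fun x => (1 - (1 - x) ^+ k.+1) / k.+1%:R + c * x ^+ 3).
move=> /= [L0 u'0 uincr ur uLip].
have v0 : v 0 = 0 by rewrite /v mulr0 mul0r.
have vN y : v (- y) = - v y by rewrite /v sqrrN mulrN mulNr.
have u0 : u 0 = 0 by rewrite /u subr0 expr1n subrr mul0r expr0n mulr0 addr0.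
have cexpn (f : R -> R) m : continuous f -> continuous (fun x => f x ^+ m).
  by move=> fc x; apply: (@continuous_comp _ _ _ f (fun y => y ^+ m) x (fc
    x)); exact: exprn_continuous.
have cid : continuous (@id R) by move=> x; exact: cvg_id.
have vc : continuous v.
  move=> y; apply: cvgM; first exact: (cvgM (cvg_cst _) (cid y)).
  apply: (cexpn (fun y => 1 - a * y ^+ 2)) => x.
  exact: (cvgB (cvg_cst _) (cvgM (cvg_cst _) (cexpn _ 2%N cid x))).
have uc : continuous u.
  move=> y; apply: cvgD; last exact: (cvgM (cvg_cst _) (cexpn _ 3%N cid y)).
  apply: cvgM; last exact: cvg_cst.
  apply: cvgB; first exact: cvg_cst.
  by apply: (cexpn (fun y => 1 - y)) => x; exact: (cvgB (cvg_cst _) (cid x)).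
have [y0 y0I vy0] : exists2 y0, y0 \in `[0, rho] & v y0 = 1.
  apply: IVT; [exact: ltW|exact: continuous_subspaceT|].
  by rewrite v0 vr ge_min le_max; apply/andP; split; apply/orP; [left|right];
    lra.
move: y0I; rewrite in_itv /= => /andP[y00 y0r].
have {}y0r : y0 < rho.
  by rewrite lt_neqAle y0r andbT; apply: contra_eq_neq vy0 => ->; rewrite vr;
    apply/eqP; lra.
have x0r : 0 < rho ^+ 2 - y0 ^+ 2 by rewrite subr_gt0 ltr_sqr ?nnegrE// ltW.
pose x0 := Num.sqrt (rho ^+ 2 - y0 ^+ 2);
  have x00 : 0 < x0 by rewrite sqrtr_gt0.
(* With this K, K s y^2 >= L (rho - s) as soon as s >= x0, because
   y^2 = (rho - s) (rho + s). *)
pose K := L / (rho * x0); have K0 : 0 <= K by rewrite divr_ge0// mulr_ge0 ?ltW.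
pose U x y := u x + K * x * y ^+ 2.
pose Q := cstQ (k.+1%:R^-1) * (1 - (1 - ReQ) ^+ k.+1) + cstQ c * ReQ ^+ 3
  + cstQ K * ReQ * ImQ ^+ 2
  + ('i%C)%:P%:P * (cstQ B * ImQ * (1 - cstQ a * ImQ ^+ 2) ^+ n.+1).
have QE z : ev Q z = U (Re z) (Im z) +i* v (Im z).
  rewrite /U /u /v [_ / k.+1%:R]mulrC; apply: ev_example; try exact: ev_cst.
  - by rewrite evC hornerC.
  - exact: ev_ReQ.
  - exact: ev_ImQ.
have diskI s z : disk 0 s z -> [/\ - s < Re z, Re z < s, - s < Im z & Im z < s].
  move=> /diskE[ss]; rewrite /= !subr0 => h.
  have hR : Re z ^+ 2 < s ^+ 2 by rewrite (le_lt_trans _ h)// lerDl sqr_ge0.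
  have hI : Im z ^+ 2 < s ^+ 2 by rewrite (le_lt_trans _ h)// lerDr sqr_ge0.
  have : `|Re z| < s by rewrite -ltr_sqr ?nnegrE ?(ltW ss)// real_normK
    ?num_real.
  have : `|Im z| < s by rewrite -ltr_sqr ?nnegrE ?(ltW ss)// real_normK
    ?num_real.
  by rewrite !ltr_norml => /andP[-> ->] /andP[-> ->].
have vinj y y' : - rho <= y <= rho -> - rho <= y' <= rho -> v y = v y' ->
  y = y'.
  move=> /andP[y1 y2] /andP[y1' y2'] vv; have [h|h|//] := ltgtP y y'.
    by have := vincr _ _ y1 h y2'; rewrite vv ltxx.
  by have := vincr _ _ y1' h y2; rewrite vv ltxx.
have Uincr x x' y : x < x' -> x' <= 1 -> U x y < U x' y.
  move=> h h'; apply: ltr_leD; first exact: uincr.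
  by rewrite ler_wpM2r ?sqr_ge0// ler_wpM2l// ltW.
have lineR t : 0 + t%:C * 1 = (t +i* 0 : C).
  by rewrite add0r mulr1.
have lineI t : 0 + t%:C * 'i%C = (0 +i* t : C).
  by apply: complex_ext; rewrite !ReImE /=; ring.
exists (size Q).+1; split=> //.
apply: (@radius_fails_of_poly R _ sigma rho r B Q) => //.
- move=> z /diskI[_ _ h1 h2]; rewrite QE /=.
  have : `|v (Im z)| <= 3 / 2 by apply: vmax; rewrite !ltW.
  have := pi_ge2 R; rewrite ler_norml => h3 /andP[h4 h5]; apply/andP; split;
    lra.
- by rewrite QE /= v0 /U u0 mulr0 mul0r addr0.
- split=> /=.
    rewrite (_ : (fun t : R => _) = u)//.
    by apply/funext => t; rewrite lineR QE /= /U expr0n mulr0 addr0.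
  rewrite (_ : (fun t : R => _) = cst 0); first exact: is_derive_cst.
  by apply/funext => t; rewrite lineR QE /= v0.
- split=> /=.
    rewrite (_ : (fun t : R => _) = cst 0).
      by rewrite mul0r mul1r subr0; exact: is_derive_cst.
    by apply/funext => t; rewrite lineI QE /= /U u0 mulr0 mul0r addr0.
  rewrite (_ : (fun t : R => _) = v); first by rewrite mul0r mul1r add0r.
  by apply/funext => t; rewrite lineI QE.
- move=> z1 z2 /set_mem /diskI[xl1 xr1 yl1 yr1] /set_mem /diskI[xl2 xr2 yl2
    yr2].
  rewrite !QE => -[hU hv].
  have hy : Im z1 = Im z2 by apply: vinj => //; rewrite !ltW.
  apply: complex_ext => //; move: hU; rewrite hy => hU.
  have [h|h|//] := ltgtP (Re z1) (Re z2).
    by have := Uincr _ _ (Im z2) h (ltW (lt_le_trans xr2 r1)); rewrite hU ltxx.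
  by have := Uincr _ _ (Im z2) h (ltW (lt_le_trans xr1 r1)); rewrite hU ltxx.
- move=> s sI; have [x [y [x0' xy ys vv]]] := vbump s sI => inj.
  have iD t : 0 <= t -> t < s -> disk 0 s (0 +i* t : C).
    move=> t0 ts; have ss : 0 < s by exact: le_lt_trans ts.
    apply/diskE; split; rewrite //= !subr0 expr0n add0r.
    by rewrite ltr_sqr ?nnegrE// ltW.
  have : (0 +i* x : C) = 0 +i* y.
    apply: inj; rewrite ?inE; [exact: iD (lt_trans xy ys)|apply: iD => //;
      lra|].
    by rewrite !QE /= vv /U u0; congr (_ +i* _); ring.
  by move=> [h]; move: xy; rewrite h ltxx.
- move=> w wD; have [Xl Xr Yl Yr] := diskI _ _ wD.
  have [y yI vy] : exists2 y, y \in `[- rho, rho] & v y = Im w.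
    apply: IVT; [lra|exact: continuous_subspaceT|].
    by rewrite vN vr ge_min le_max; apply/andP; split; apply/orP;
      [left|right]; lra.
  move: yI; rewrite in_itv /= => /andP[yl yr].
  have yy0 : y < y0.
    rewrite ltNge le_eqVlt; apply/negP => /orP[/eqP h|h].
      by move: vy; rewrite -h vy0; lra.
    by have := vincr y0 y _ h yr; rewrite vy vy0 => h';
      have := h' ltac:(lra); lra.
  have y0y : - y0 < y.
    rewrite ltNge le_eqVlt; apply/negP => /orP[/eqP h|h].
      by move: vy; rewrite h vN vy0; lra.
    have := vincr y (- y0) yl h; rewrite vy vN vy0 => h';
      have := h' ltac:(lra); lra.
  have yy2 : y ^+ 2 <= y0 ^+ 2 by nra.
  pose s := Num.sqrt (rho ^+ 2 - y ^+ 2).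
  have s2 : s ^+ 2 = rho ^+ 2 - y ^+ 2 by rewrite sqr_sqrtr//; lra.
  have x0s : x0 <= s by rewrite ler_sqrt; lra.
  have sr' : s <= rho.
    by rewrite -ler_sqr ?nnegrE ?(ltW r0) ?(le_trans (ltW x00) x0s)// s2 gerBl
      sqr_ge0.
  have [us uNs] : sigma - u s <= L * (rho - s) /\ u (- s) <= - u s.
    by apply: uLip; rewrite sr' (le_trans (ltW x00)).
  have Ks : L * (rho - s) <= K * s * y ^+ 2.
    have -> : L * (rho - s) = K * (rho - s) * (x0 * rho).
      by rewrite /K; field; rewrite !gt_eqF.
    have -> : K * s * y ^+ 2 = K * (rho - s) * (s * (rho + s)).
      have -> : y ^+ 2 = rho ^+ 2 - s ^+ 2 by rewrite s2; ring.
      by ring.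
    apply: ler_wpM2l; first by rewrite mulr_ge0// subr_ge0.
    apply: ler_pM => //; try exact: ltW.
    by rewrite lerDl (le_trans (ltW x00)).
  have Us : sigma <= U s y by rewrite /U; lra.
  have UNs : U (- s) y <= - sigma by rewrite /U mulrN mulNr; lra.
  have Uc : continuous (fun x => U x y).
    move=> x; apply: cvgD; first exact: uc.
    exact: (cvgM (cvgM (cvg_cst _) (cid x)) (cvg_cst _)).
  have [x xI Ux] : exists2 x, x \in `[- s, s] & U x y = Re w.
    apply: IVT; [lra|exact: continuous_subspaceT|].
    by rewrite ge_min le_max; apply/andP; split; apply/orP; [left|right]; lra.
  move: xI; rewrite in_itv /= => /andP[]; rewrite !le_eqVlt.
  move=> /orP[/eqP h|xl] => [|/orP[/eqP h|xr]].
  + by move: UNs; rewrite h Ux; lra.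
  + by move: Us; rewrite -h Ux; lra.
  exists (x +i* y : C); last by rewrite QE; apply: complex_ext.
  by apply/diskE; split; rewrite //= !subr0; nra.
- move=> [z /diskI[xl xr yl yr]]; rewrite QE => -[hU hv].
  have hy : Im z = 0 by apply: vinj; rewrite ?v0 // ?oppr_le0 ?ltW//.
  move: hU; rewrite hy /U expr0n mulr0 addr0 => hU.
  by have := uincr _ _ xr r1; rewrite hU ur ltxx.
Qed.

End Example.

Theorem lemma2p2 (R : realType) :
  (forall (alpha : nat) (sigma rho : R) (f : R[i]^o -> R[i]^o),
     (0 < alpha)%N -> 0 < sigma <= 1 -> 0 < rho <= 1 ->
     admissible alpha sigma rho f ->
     contains_schlicht_disk f (disk 0 rho) (cosh sigma)%:C (sinh sigma)) /\
  (forall sigma rho r : R,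
     0 < sigma <= 1 -> 0 < rho <= 1 -> sinh sigma < r ->
     exists alpha : nat, (0 < alpha)%N /\ radius_fails alpha sigma rho r) /\
  (forall alpha : nat, (0 < alpha)%N ->
     exists sigma rho : R, [/\ 0 < sigma <= 1, 0 < rho <= 1
       & forall r : R, sinh sigma < r -> radius_fails alpha sigma rho r]).
Proof.
split; last split.
- move=> alpha sigma rho f a0 /andP[s0 _] /andP[_ r1].
  exact: admissible_schlicht.
- move=> sigma rho r sI rI sr; exact: radius_fails_exists.
- move=> alpha a0; exists 1, 1; split; rewrite ?ltr01 ?lexx// => r sr.
  exact: radius_fails_unit.
Qed.
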